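(* Let $f(x,y)=\sum_{k,l=1}^M\lambda_{k,l}\,g_k(x)h_l(y)$, $M\in\{1,2,\dots\}\cup\{\infty\}$, where $\{g_k\}$ and $\{h_l\}$ are centered and orthonormal: $\mathbf E g_k(\xi)=\mathbf E h_l(\eta)=0$, $\mathbf E g_k(\xi)g_{k'}(\xi)=\delta_{k,k'}$, $\mathbf E h_l(\eta)h_{l'}(\eta)=\delta_{l,l'}$, with $\sigma^2:=\sum_{k,l}\lambda_{k,l}^2\in(0,\infty)$ (series converging in $L_2(\mu\otimes\nu)$), and assume $0<W[f](2)<\infty$. Let $L=L(n_1,n_2)=\{(i,j):1\le i\le n_1,\ 1\le j\le n_2\}$. Then, as $\min(n_1,n_2)\to\infty$, $$S_L[f]\xrightarrow{d} S_\infty:=\sum_{k,l=1}^M\lambda_{k,l}\,\tau_k\,\theta_l,$$ where $\tau_1,\tau_2,\dots,\theta_1,\theta_2,\dots$ are mutually independent standard normal random variables.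
   Context: Let $(X,\mathcal B,\mu)$, $(Y,\mathcal C,\nu)$ be probability spaces and $\xi(1),\xi(2),\dots,\eta(1),\eta(2),\dots$ mutually independent random variables, $\xi(i)$ with law $\mu$, $\eta(j)$ with law $\nu$; $\xi=\xi(1)$, $\eta=\eta(1)$; $|\zeta|_p=(\mathbf E|\zeta|^p)^{1/p}$ and $|f|_p=|f(\xi,\eta)|_p$. For finite non-empty $L\subset\mathbb Z_+^2$, $S_L[f]:=|L|^{-1/2}\sum_{(k_1,k_2)\in L}f(\xi(k_1),\eta(k_2))$. $K_R(p)$ is the smallest constant $K$ such that for all $n$, real $c_i$ and i.i.d. centered $\zeta_i$ with finite $p$-th moment, $|\sum c_i\zeta_i|_p\le K(\sum c_i^2)^{1/2}|\zeta_1|_p$. For finite $M$, $D[M]$ is the set of functions $\sum_{i,j=1}^{M}\lambda_{i,j}g_i(x)h_j(y)$ with centered $g_i\in L_p(\mu)$, $h_j\in L_p(\nu)$; $\|F\|D_p:=\inf\sum|\lambda_{i,j}||g_i(\xi)|_p|h_j(\eta)|_p$ over such (possibly infinite, $L_p$-convergent) representations of $F$; $Q_M[f]_p:=\inf_{\tilde f\in D[M]}|f-\tilde f|_p$ with $Z_M[f]$ a minimizer; and $W[f](p):=\sup_{L}\inf_{M\ge1}[K_R^2(p)\|Z_M[f]\|D_p+|L|^{1/2}Q_M[f]_p]$, sup over finite non-empty $L\subset\mathbb Z_+^2$. *)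

(* Defs.v *)
From HB Require Import structures.
From mathcomp Require Import all_boot all_order all_algebra.
From mathcomp Require Import all_classical all_reals all_analysis.
From mathcomp Require Import normal_distribution.

Set Implicit Arguments.
Unset Strict Implicit.
Unset Printing Implicit Defensive.

Import Order.TTheory GRing.Theory Num.Theory.
Import numFieldNormedType.Exports.

Local Open Scope classical_set_scope.
Local Open Scope ring_scope.

Section Defs.
Context {R : realType}.

(* Index range {0,...,M-1} for finite M = Some m, all of nat for M = None (= infinity). *)
Definition inM (M : option nat) (k : nat) : bool :=
  if M is Some m then (k < m)%N else true.

Definition indep_family {dO dX dY : measure_display}
  {Om : measurableType dO} {X : measurableType dX} {Y : measurableType dY}
  (P : probability Om R) (mu : set X -> \bar R) (nu : set Y -> \bar R)
  (xi : nat -> Om -> X) (eta : nat -> Om -> Y) : Prop :=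
  [/\ (forall i, measurable_fun setT (xi i)),
      (forall j, measurable_fun setT (eta j)) &
      forall (I J : seq nat) (A : nat -> set X) (B : nat -> set Y),
        uniq I -> uniq J ->
        (forall i, measurable (A i)) -> (forall j, measurable (B j)) ->
        P ((\bigcap_(i in [set` I]) (xi i @^-1` A i)) `&`
           (\bigcap_(j in [set` J]) (eta j @^-1` B j)))
        = ((\prod_(i <- I) mu (A i)) * (\prod_(j <- J) nu (B j)))%E].

Definition pnorm {dO : measure_display} {Om : measurableType dO}
  (P : probability Om R) (p : R) (Z : Om -> R) : \bar R :=
  Lnorm P p%:E (EFin \o Z).

Definition iid_centered {dO : measure_display} {Om : measurableType dO}
  (P : probability Om R) (p : R) (n : nat) (z : 'I_n -> Om -> R) : Prop :=
  [/\ (forall i, measurable_fun setT (z i)),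
      (forall B : 'I_n -> set R, (forall i, measurable (B i)) ->
          P (\bigcap_(i in [set: 'I_n]) (z i @^-1` B i))
          = (\prod_(i < n) P (z i @^-1` B i))%E),
      (forall i j (B : set R), measurable B -> P (z i @^-1` B) = P (z j @^-1` B)),
      (forall i, (\int[P]_w (z i w)%:E = 0)%E) &
      (forall i, (\int[P]_w (`|z i w| `^ p)%:E < +oo)%E)].

Definition rosenthal_ok (p K : R) : Prop :=
  forall (dO : measure_display) (Om : measurableType dO) (P : probability Om R)
         (n : nat) (c : 'I_n.+1 -> R) (z : 'I_n.+1 -> Om -> R),
    iid_centered P p z ->
    (pnorm P p (fun w => (\sum_(i < n.+1) c i * z i w)%R)
     <= K%:E * (Num.sqrt (\sum_(i < n.+1) c i ^+ 2)%R)%:E * pnorm P p (z ord0))%E.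

(* K_R(p): the smallest such constant (+oo if none) *)
Definition K_R (p : R) : \bar R :=
  ereal_inf [set K%:E | K in rosenthal_ok p].

Section TwoVar.
Context {dO dX dY : measure_display} {Om : measurableType dO}
  {X : measurableType dX} {Y : measurableType dY}
  (P : probability Om R) (mu : probability X R) (nu : probability Y R)
  (xi : Om -> X) (eta : Om -> Y) (p : R).
(* xi, eta play the role of xi = xi(1), eta = eta(1). *)

Definition centered_Lp {dT : measure_display} {T : measurableType dT}
  (m : probability T R) (g : T -> R) : Prop :=
  [/\ measurable_fun setT g, (Lnorm m p%:E (EFin \o g) < +oo)%E &
      (\int[m]_x (g x)%:E = 0)%E].

Definition inD (M : nat) (F : X -> Y -> R) : Prop :=
  exists (lam : nat -> nat -> R) (g : nat -> X -> R) (h : nat -> Y -> R),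
    [/\ (forall i, centered_Lp mu (g i)), (forall j, centered_Lp nu (h j)) &
        F = (fun x y => \sum_(i < M) \sum_(j < M) lam i j * g i x * h j y)].

Definition normD (F : X -> Y -> R) : \bar R :=
  ereal_inf [set c | exists (lam : nat -> nat -> R) (g : nat -> X -> R)
                            (h : nat -> Y -> R),
     [/\ (forall i, centered_Lp mu (g i)), (forall j, centered_Lp nu (h j)),
         (fun m : nat => pnorm P p (fun w => F (xi w) (eta w) -
             \sum_(i < m) \sum_(j < m) lam i j * g i (xi w) * h j (eta w)))
           @ \oo --> 0%E &
         c = \esum_(ij in [set: nat * nat])
               (`|lam ij.1 ij.2|%:E * pnorm P p (g ij.1 \o xi)
                  * pnorm P p (h ij.2 \o eta))%E]].

Definition QM (M : nat) (f : X -> Y -> R) : \bar R :=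
  ereal_inf [set pnorm P p (fun w => f (xi w) (eta w) - F (xi w) (eta w))
            | F in inD M].

Definition is_minimizer (M : nat) (f Z : X -> Y -> R) : Prop :=
  inD M Z /\ pnorm P p (fun w => f (xi w) (eta w) - Z (xi w) (eta w)) = QM M f.

(* W[f](p), computed with the family of minimizers Z = (Z_M)_M;
   L ranges over finite non-empty index sets (duplicate-free sequences). *)
Definition W (f : X -> Y -> R) (Z : nat -> X -> Y -> R) : \bar R :=
  ereal_sup [set ereal_inf
     [set (K_R p * K_R p * normD (Z M)
           + (Num.sqrt (size L)%:R)%:E * QM M f)%E | M in [set M : nat | (0 < M)%N]]
   | L in [set L : seq (nat * nat) | uniq L /\ L != [::]]].

End TwoVar.

Definition S_L {dO dX dY : measure_display} {Om : measurableType dO}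
  {X : measurableType dX} {Y : measurableType dY}
  (xi : nat -> Om -> X) (eta : nat -> Om -> Y) (f : X -> Y -> R)
  (L : seq (nat * nat)) (w : Om) : R :=
  (Num.sqrt (size L)%:R)^-1 * \sum_(ij <- L) f (xi ij.1 w) (eta ij.2 w).

End Defs.

Definition rect (n1 n2 : nat) : seq (nat * nat) :=
  [seq (i, j) | i <- iota 0 n1, j <- iota 0 n2].

(* Main.v *)
Require Import Defs.
From HB Require Import structures.
From mathcomp Require Import all_boot all_order all_algebra.
From mathcomp Require Import all_classical all_reals all_analysis.
From mathcomp Require Import normal_distribution.
From mathcomp Require Import measurable_realfun.
From mathcomp Require Import ring lra.
Import Order.TTheory GRing.Theory Num.Theory.
Import numFieldNormedType.Exports.
Local Open Scope classical_set_scope.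
Local Open Scope ring_scope.

(** The kernel f is an L_2-limit of the finite sums f_m = sum_{k,l<m} lam_{k,l} g_k h_l.
    By orthonormality |S_L[f_m'] - S_L[f_m]|_2 = |f_m' - f_m|_2 for every rectangle L,
    and for fixed L one has |S_L[f] - S_L[f_m']|_2 <= |L|^(1/2) |f - f_m'|_2, which tends
    to 0 as m' grows; so S_L[f_m] approximates S_L[f] in L_2 uniformly in L.  Moreover
    S_L[f_m] = sum lam_{k,l} U_k V_l, where U_k and V_l are the normalized sums of the
    g_k(xi(i)) and of the h_l(eta(j)), and the families U and V are independent.  For V
    frozen this is a normalized sum of i.i.d. centered variables, so Lindeberg's
    replacement method turns the U_k into the tau_k, uniformly for bounded coefficients;
    then for tau frozen the V_l are turned into the theta_l.  The test functions with a
    cubic Taylor bound for which this works suffice for weak convergence, because the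
    second moments are bounded and every continuous function is uniformly close on a
    compact interval to a finite combination of smooth steps. *)

(** * Independence and decoupling *)

(** Only second moments are available, while a cubic Taylor bound alone would ask for third ones.
    The remainder is therefore min(h^2, |h|^3): its first entry makes it integrable, and after
    scaling by 1/sqrt(n) its mean is o(1/n) by dominated convergence. The obstacle is uniformity.
    The coefficients seen by the U_k are linear forms in the V_l, random and dependent on n2, so the
    limit theorem for U must come with a threshold that depends only on a bound A for the
    coefficients. Coefficients beyond A are discarded by Chebyshev, since their second moments do
    not depend on the rectangle. Replacement acts on the operators phi -> E phi(x + G) and not on
    random variables. These operators commute and contract, so the xi(i) and the Gaussian variables
    may live on unrelated probability spaces, and the Taylor expansion is needed for phi only.
    Freezing one family means integrating over two independent copies of the sample space. *)

Section independence.
Set Implicit Arguments.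
Unset Strict Implicit.
Context {R : realType}.

(** Both sides are finite measures in A that agree on the pi-system [G], hence on the sigma-algebra
    it generates. *)
Lemma indep_g_sigma {d} {T : measurableType d} (P : probability T R)
    (G : set (set T)) (B : set T) :
  G `<=` measurable -> setI_closed G -> G setT -> measurable B ->
  (forall A, G A -> P (A `&` B) = P A * P B)%E ->
  forall A, <<s G >> A -> P (A `&` B) = (P A * P B)%E.
Proof.
move=> Gm GI GT mB GB A sGA.
have PB : P B \is a fin_num by exact: fin_num_measure.
have PBE : (fine (P B))%:E = P B by rewrite fineK.
have PB0 : 0 <= fine (P B) by exact: fine_ge0.
have := @g_sigma_algebra_measure_unique _ _ _ G Gm (fun=> setT) (fun=> GT) _
   (mrestr P mB) (mscale (NngNum PB0) P) GI.
move=> /(_ _ _ _ A sGA) H.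
have -> : P (A `&` B) = mrestr P mB A by [].
rewrite H.
- by rewrite /mscale -[X in _ = (_ * X)%E]PBE muleC.
- by rewrite -subTset => x _; exists 0%N.
- by move=> C GC; rewrite -[LHS]/(P (C `&` B)) GB// /mscale -[X in (_ * X)%E = _]PBE muleC.
- by move=> k; rewrite -[X in (X < _)%E]/(P (setT `&` B)) setTI ltey_eq PB.
Qed.

Lemma indep_g_sigma2 {d} {T : measurableType d} (P : probability T R)
    (G1 G2 : set (set T)) :
  G1 `<=` measurable -> setI_closed G1 -> G1 setT ->
  G2 `<=` measurable -> setI_closed G2 -> G2 setT ->
  (forall A B, G1 A -> G2 B -> P (A `&` B) = P A * P B)%E ->
  forall A B, <<s G1 >> A -> <<s G2 >> B -> P (A `&` B) = (P A * P B)%E.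
Proof.
move=> G1m G1I G1T G2m G2I G2T GG A B sA sB.
have mB : measurable B by apply: smallest_sub sB => //; exact: sigma_algebra_measurable.
apply: (@indep_g_sigma _ _ P G1 B) => //.
move=> C G1C; rewrite setIC muleC; apply: (@indep_g_sigma _ _ P G2 C) => //.
  exact: G1m.
by move=> D G2D; rewrite setIC GG// muleC.
Qed.

(** The joint law of (U, V) is the product of the law of U with [m2], because they agree on
    rectangles; Tonelli does the rest. That V has law [m2] is the case where A is the whole
    space. *)
Lemma indep_integral {d d1 d2} {T : measurableType d} {T1 : measurableType d1}
    {T2 : measurableType d2} (P : probability T R) (m2 : probability T2 R)
    (U : T -> T1) (V : T -> T2) (F : T1 * T2 -> \bar R) :
  measurable_fun setT U -> measurable_fun setT V ->
  (forall A B, measurable A -> measurable B ->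
     P (U @^-1` A `&` V @^-1` B) = P (U @^-1` A) * m2 B)%E ->
  measurable_fun [set: T1 * T2] F -> (forall z, 0 <= F z)%E ->
  (\int[P]_w F (U w, V w) = \int[P]_w \int[m2]_t F (U w, t))%E.
Proof.
move=> mU mV UV mF F0.
pose U' : {mfun T >-> T1} := HB.pack U (isMeasurableFun.Build _ _ _ _ U mU).
pose UV0 (w : T) := (U w, V w).
have mUV0 : measurable_fun setT UV0 by exact/measurable_fun_pair.
pose UV' : {mfun T >-> (T1 * T2)%type} :=
  HB.pack UV0 (isMeasurableFun.Build _ _ _ _ UV0 mUV0).
have -> : (\int[P]_w F (U w, V w) = \int[distribution P UV']_z F z)%E.
  by rewrite ge0_integral_distribution.
have E : (\int[distribution P UV']_z F z = \int[distribution P U' \x m2]_z F z)%E.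
  apply: eq_measure_integral => A mA _; apply/esym.
  apply: (@product_measure_unique _ _ _ _ _ (distribution P U') m2
    (distribution P UV')) => //.
rewrite E fubini_tonelli1//= (ge0_integral_distribution U')//.
- exact: measurable_fun_fubini_tonelli_F.
- by move=> y; apply: integral_ge0.
Qed.


Lemma measurable_fun_g_sigma {d d'} {T : measurableType d} {T' : measurableType d'}
    (G : set (set T)) (H : T -> T') : G `<=` measurable ->
  measurable_fun setT (H : g_sigma_algebraType G -> T') -> measurable_fun setT H.
Proof.
move=> Gm mH _ B mB; have := mH measurableT B mB.
by apply: smallest_sub => //; exact: sigma_algebra_measurable.
Qed.

(** Measurability on [g_sigma_algebraType G1] expresses that U depends only on the information in
    [G1], and likewise for V. The inner integral runs over a second copy of the same space. *)
Lemma indep_integral2 {d d1 d2} {T : measurableType d} {T1 : measurableType d1}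
    {T2 : measurableType d2} (P : probability T R) (G1 G2 : set (set T))
    (U : T -> T1) (V : T -> T2) (F : T1 * T2 -> \bar R) :
  G1 `<=` measurable -> setI_closed G1 -> G1 setT ->
  G2 `<=` measurable -> setI_closed G2 -> G2 setT ->
  (forall A B, G1 A -> G2 B -> P (A `&` B) = P A * P B)%E ->
  measurable_fun setT (U : g_sigma_algebraType G1 -> T1) ->
  measurable_fun setT (V : g_sigma_algebraType G2 -> T2) ->
  measurable_fun [set: T1 * T2] F -> (forall z, 0 <= F z)%E ->
  (\int[P]_w F (U w, V w) = \int[P]_w \int[P]_w' F (U w, V w'))%E.
Proof.
move=> G1m G1I G1T G2m G2I G2T GG mU mV mF F0.
have mU' := measurable_fun_g_sigma G1m mU.
have mV' := measurable_fun_g_sigma G2m mV.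
pose V' : {mfun T >-> T2} := HB.pack V (isMeasurableFun.Build _ _ _ _ V mV').
rewrite (@indep_integral _ _ _ _ _ _ P (distribution P V') U V)//.
  apply: eq_integral => w _; rewrite ge0_integral_distribution//.
  by apply: measurableT_comp => //; exact: measurable_pair1.
move=> A B mA mB; rewrite (@indep_g_sigma2 _ _ P G1 G2)//.
  by rewrite -[X in <<s _ >> X]setTI; exact: mU.
by rewrite -[X in <<s _ >> X]setTI; exact: mV.
Qed.

Definition iid_seq {d d'} {Om : measurableType d} {T : measurableType d'}
    (P : probability Om R) (rho : probability T R) (xi : nat -> Om -> T) :=
  (forall i, measurable_fun setT (xi i)) /\
  (forall n A, (forall i, measurable (A i)) ->
    P (\bigcap_(i in [set` iota 0 n]) (xi i @^-1` A i)) =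
    \prod_(i <- iota 0 n) rho (A i))%E.

(* Only the first n coordinates are constrained; A i = setT leaves coordinate i free. *)
Definition cyl {d d'} {Om : measurableType d} {T : measurableType d'}
    (xi : nat -> Om -> T) (n : nat) : set (set Om) :=
  [set C | exists2 A : nat -> set T, (forall i, measurable (A i)) &
     C = \bigcap_(i in [set` iota 0 n]) (xi i @^-1` A i)].

Section cylinders.
Context {d d'} {Om : measurableType d} {T : measurableType d'}
  (xi : nat -> Om -> T).

Lemma cylI n : setI_closed (cyl xi n).
Proof.
move=> _ _ [A mA ->] [B mB ->]; exists (fun i => A i `&` B i) => [i|].
  exact: measurableI.
by rewrite -bigcapI; apply: eq_bigcapr => i _; rewrite preimage_setI.
Qed.

Lemma cylT n : cyl xi n setT.
Proof.
by exists (fun=> setT) => //; rewrite bigcapT.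
Qed.

Lemma cyl_coord n i : (i < n)%N ->
  measurable_fun setT (xi i : g_sigma_algebraType (cyl xi n) -> T).
Proof.
move=> ni _ B mB; rewrite setTI; apply: sub_sigma_algebra.
exists (fun j => if j == i then B else setT) => [j|]; first by case: ifP.
apply/seteqP; split => [w Bw j/= _|w /(_ i)]/=.
  by case: eqP => // ->.
by rewrite eqxx; apply; rewrite mem_iota.
Qed.

Lemma cyl_measurable n : (forall i, measurable_fun setT (xi i)) ->
  cyl xi n `<=` measurable.
Proof.
move=> mxi _ [A mA ->]; apply: fin_bigcap_measurable => // i _.
by rewrite -[X in measurable X]setTI; exact: mxi.
Qed.

Context (P : probability Om R) (rho : probability T R) (iid : iid_seq P rho xi).

Let iid_cap n A B : (forall i, measurable (A i)) -> measurable B ->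
  P (\bigcap_(i in [set` iota 0 n]) (xi i @^-1` A i) `&` xi n @^-1` B) =
  ((\prod_(i <- iota 0 n) rho (A i)) * rho B)%E.
Proof.
move=> mA mB; pose A' j := if j == n then B else A j.
have nn i : i \in iota 0 n -> (i == n) = false.
  by rewrite mem_iota add0n => /andP[_ ni]; rewrite ltn_eqF.
have iS : iota 0 n.+1 = iota 0 n ++ [:: n] by rewrite -addn1 iotaD.
have -> : \bigcap_(i in [set` iota 0 n]) (xi i @^-1` A i) `&` xi n @^-1` B =
    \bigcap_(i in [set` iota 0 n.+1]) (xi i @^-1` A' i).
  apply/seteqP; split => [w [Aw Bw] j|w Aw].
    move=> jn; have {jn} : j \in iota 0 n.+1 by exact: jn.
    rewrite iS mem_cat inE /A' => /orP[jn|/eqP ->].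
      by rewrite nn//; exact: Aw.
    by rewrite /= eqxx.
  split=> [i /= ni|].
    have iS' : i \in iota 0 n.+1 by rewrite iS mem_cat ni.
    by have := Aw i iS'; rewrite /= /A' nn.
  have nS : n \in iota 0 n.+1 by rewrite iS mem_cat inE eqxx orbT.
  by have := Aw n nS; rewrite /= /A' eqxx.
rewrite iid.2//; last by move=> i; rewrite /A'; case: ifP.
rewrite iS big_cat/= big_seq1 /A' eqxx; congr (_ * _)%E.
by rewrite !big_seq; apply: eq_bigr => i /nn ->.
Qed.

Lemma iid_law n B : measurable B -> P (xi n @^-1` B) = rho B.
Proof.
move=> mB; have := @iid_cap n (fun=> setT) B (fun=> measurableT) mB.
rewrite bigcapT ?setTI => [->|//].
by rewrite big1 ?mul1e// => i _; rewrite probability_setT.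
Qed.

(** The induction step of all computations on i.i.d. sums: coordinate n is independent of whatever
    is built from the coordinates below n, so it can be integrated out against [rho]. *)
Lemma iid_integral n {d1} {T1 : measurableType d1} (H : Om -> T1)
    (F : T1 * T -> \bar R) :
  measurable_fun setT (H : g_sigma_algebraType (cyl xi n) -> T1) ->
  measurable_fun [set: T1 * T] F -> (forall z, 0 <= F z)%E ->
  (\int[P]_w F (H w, xi n w) = \int[P]_w \int[rho]_t F (H w, t))%E.
Proof.
move=> mH mF F0; have cm := cyl_measurable (n := n) iid.1.
apply: indep_integral => //.
- exact: measurable_fun_g_sigma mH.
- exact: iid.1.
- move=> A B mA mB; rewrite (@indep_g_sigma _ _ P (cyl xi n))//.
  + by rewrite iid_law.
  + exact: cylI.
  + exact: cylT.
  + by rewrite -[X in measurable X]setTI; exact: iid.1.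
  + by move=> _ [C mC ->]; rewrite iid_cap// iid.2// iid_law.
  + by rewrite -[X in <<s _ >> X]setTI; exact: mH.
Qed.

End cylinders.

End independence.

(** * Averaging operators and second moments of i.i.d. sums *)

Section averages.
Set Implicit Arguments.
Unset Strict Implicit.
Context {R : realType}.
Implicit Types (phi : R -> R) (C : R).

(** Values in [0, 1] make all expectations finite and bound their differences by 1; the Lipschitz
    bound turns closeness in L_2 into closeness of expectations. Both properties survive averaging
    with the same C. *)
Definition lip_test C phi :=
  [/\ 0 <= C, (forall x, 0 <= phi x <= 1) &
      forall x y, `|phi x - phi y| <= C * `|x - y|].

Lemma lip_test_continuous C phi : lip_test C phi -> continuous phi.
Proof.
move=> [C0 _ lip] x; apply/cvgrPdist_le => e e0.
have C1 : 0 < C + 1 by rewrite ltr_wpDl.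
near=> y; rewrite (le_trans (lip _ _))//.
have : `|x - y| <= e / (C + 1).
  by near: y; apply: cvgr_dist_le; [exact: cvg_id|rewrite divr_gt0].
move=> xy; rewrite (@le_trans _ _ ((C + 1) * (e / (C + 1))))//.
  by apply: ler_pM => //; rewrite lerDl.
by rewrite mulrC divfK// gt_eqF.
Unshelve. all: by end_near. Qed.

Lemma lip_test_measurable C phi : lip_test C phi -> measurable_fun setT phi.
Proof. by move=> phiC; apply: continuous_measurable_fun; exact: lip_test_continuous phiC. Qed.

Lemma bounded_integrable {d} {T : measurableType d} (P : probability T R)
    (f : T -> R) (B : R) :
  measurable_fun setT f -> (forall x, `|f x| <= B) ->
  P.-integrable setT (EFin \o f).
Proof.
move=> mf fB; apply: (@le_integrable _ _ _ P setT measurableT _ (EFin \o cst B)).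
- exact/measurable_EFinP.
- by move=> x _ /=; rewrite lee_fin (le_trans (fB x))// ler_norm.
- by apply/finite_measure_integrable_cst.
Qed.

Lemma Rintegral_cst_prob {d} {T : measurableType d} (P : probability T R) (r : R) :
  \int[P]_(_ in setT) r = r.
Proof. by rewrite Rintegral_cst//= probability_setT mulr1. Qed.

Lemma integral_cst_prob {d} {T : measurableType d} (P : probability T R) (r : R) :
  (\int[P]_(_ in setT) r%:E = r%:E)%E.
Proof. by rewrite integral_cst//= probability_setT mule1. Qed.

Section test_comp.
Context {d} {T : measurableType d} (P : probability T R) (C : R) (phi : R -> R)
  (X : T -> R).
Hypotheses (phiC : lip_test C phi) (mX : measurable_fun setT X).

Lemma test_comp_measurable : measurable_fun setT (fun w => phi (X w)).
Proof. by apply: measurableT_comp mX; exact: lip_test_measurable phiC. Qed.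

Lemma test_comp_integrable : P.-integrable setT (fun w => (phi (X w))%:E).
Proof.
apply: (@bounded_integrable _ _ P (fun w => phi (X w)) 1).
  exact: test_comp_measurable.
by move=> x; case: phiC => _ /(_ (X x)) /andP[? ?] _; rewrite ger0_norm.
Qed.

Lemma test_comp_EFin :
  ((\int[P]_w phi (X w))%:E = \int[P]_w (phi (X w))%:E)%E.
Proof. by rewrite fineK//; apply: integrable_fin_num => //; exact: test_comp_integrable. Qed.

Lemma test_comp_01 : 0 <= \int[P]_w phi (X w) <= 1.
Proof.
case: (phiC) => _ phi01 _.
rewrite Rintegral_ge0 => [|x _]; last by case/andP: (phi01 (X x)).
rewrite /= -[leRHS](Rintegral_cst_prob P); apply: le_Rintegral => //.
- exact: test_comp_integrable.
- exact: finite_measure_integrable_cst.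
- by move=> x _; case/andP: (phi01 (X x)).
Qed.

End test_comp.

(** The convolution operator attached to the law of G. Variables from different probability spaces
    can be exchanged at this level without a joint realization. *)
Definition avg {d} {T : measurableType d} (rho : probability T R) (G : T -> R)
  phi (x : R) : R := \int[rho]_t phi (x + G t).

Lemma avg_lip {d} {T : measurableType d} (rho : probability T R) (G : T -> R) C phi :
  measurable_fun setT G -> lip_test C phi -> lip_test C (avg rho G phi).
Proof.
move=> mG phiC; have mxG x : measurable_fun setT (fun t => x + G t).
  exact: measurable_funD.
split; [by case: phiC|by move=> x; exact: test_comp_01 phiC _|move=> x y].
have iB : rho.-integrable setT (EFin \o (fun t => phi (x + G t) - phi (y + G t))).
  exact: (integrableB measurableT (test_comp_integrable _ phiC (mxG x))
    (test_comp_integrable _ phiC (mxG y))).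
rewrite /avg -RintegralB//; [|exact: test_comp_integrable phiC _..].
apply: le_trans (le_normr_Rintegral _ _) _ => //.
rewrite -[leRHS](Rintegral_cst_prob rho).
apply: le_Rintegral => //.
- exact: integrable_norm.
- exact: finite_measure_integrable_cst.
- move=> t _ /=; case: phiC => _ _ lip; apply: le_trans (lip _ _) _.
  by rewrite opprD addrACA subrr addr0.
Qed.

Lemma avg_EFin {d} {T : measurableType d} (rho : probability T R) (G : T -> R) C phi x :
  measurable_fun setT G -> lip_test C phi ->
  ((avg rho G phi x)%:E = \int[rho]_t (phi (x + G t))%:E)%E.
Proof. by move=> mG phiC; rewrite (test_comp_EFin _ phiC)//; exact: measurable_funD. Qed.

Lemma avg_comm {d d'} {T : measurableType d} {T' : measurableType d'}
    (rho : probability T R) (rho' : probability T' R) (G : T -> R) (G' : T' -> R)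
    C phi :
  measurable_fun setT G -> measurable_fun setT G' -> lip_test C phi ->
  avg rho G (avg rho' G' phi) = avg rho' G' (avg rho G phi).
Proof.
move=> mG mG' phiC; apply/funext => x; apply: EFin_inj.
have lG := avg_lip rho mG phiC; have lG' := avg_lip rho' mG' phiC.
rewrite (avg_EFin _ _ mG lG') (avg_EFin _ _ mG' lG).
under eq_integral => t _ do rewrite (avg_EFin _ _ mG' phiC).
under [RHS]eq_integral => t _ do rewrite (avg_EFin _ _ mG phiC).
rewrite (@fubini_tonelli _ _ _ _ _ rho rho' (fun z => (phi (x + G z.1 + G' z.2))%:E))//=.
- by apply: eq_integral => t _; apply: eq_integral => t' _; rewrite addrAC.
- apply/measurable_EFinP/(test_comp_measurable phiC).
  apply: measurable_funD; first apply: measurable_funD => //.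
    exact: measurableT_comp.
  exact: measurableT_comp.
- by move=> z; rewrite lee_fin; case: phiC => _ /(_ (x + G z.1 + G' z.2))/andP[].
Qed.

(* Integrating out the last coordinate first, avgs n phi x is the expectation of
   phi (x + sum_{i<n} G_i(xi(i))) for an i.i.d. sequence xi: see iid_avgs. *)
Fixpoint avgs {d} {T : measurableType d} (rho : probability T R) (G : nat -> T -> R)
    (n : nat) phi : R -> R :=
  if n is n'.+1 then avgs rho G n' (avg rho (G n') phi) else phi.

Section iid.
Context {d d'} {Om : measurableType d} {T : measurableType d'}
  (P : probability Om R) (rho : probability T R) (xi : nat -> Om -> T)
  (iid : iid_seq P rho xi) (G : nat -> T -> R)
  (mG : forall i, measurable_fun setT (G i)).

Lemma cyl_sum x n : measurable_fun setT
  (fun w : g_sigma_algebraType (cyl xi n) => x + \sum_(i < n) G i (xi i w)).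
Proof.
apply: measurable_funD => //; apply: measurable_sum => i.
by apply: measurableT_comp => //; exact: cyl_coord.
Qed.

Lemma measurable_iid_sum x n :
  measurable_fun setT (fun w => x + \sum_(i < n) G i (xi i w)).
Proof.
apply: measurable_fun_g_sigma (@cyl_sum x n).
by apply: cyl_measurable; exact: iid.1.
Qed.

Lemma iid_avgs C phi n x : lip_test C phi ->
  \int[P]_w phi (x + \sum_(i < n) G i (xi i w)) = avgs rho G n phi x.
Proof.
elim: n phi => [|n IH] phi phiC /=.
  under eq_Rintegral do rewrite big_ord0 addr0.
  exact: Rintegral_cst_prob.
rewrite -IH; last exact: avg_lip.
apply: EFin_inj; rewrite (test_comp_EFin _ phiC); last exact: measurable_iid_sum.
rewrite (test_comp_EFin _ (avg_lip rho (mG n) phiC)); last exact: measurable_iid_sum.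
under eq_integral do rewrite big_ord_recr/= addrA.
rewrite (iid_integral iid (H := fun w => x + \sum_(i < n) G i (xi i w))
  (F := fun z => (phi (z.1 + G n z.2))%:E))//.
- by apply: eq_integral => w _; rewrite (avg_EFin _ _ (mG n) phiC).
- exact: cyl_sum.
- apply/measurable_EFinP/(test_comp_measurable phiC).
  by apply: measurable_funD => //; exact: measurableT_comp.
- by move=> z; rewrite lee_fin; case: phiC => _ /(_ (z.1 + G n z.2))/andP[].
Qed.

End iid.

Definition centered {d} {T : measurableType d} (rho : probability T R) (G : T -> R)
    (s : R) :=
  [/\ measurable_fun setT G, rho.-integrable setT (EFin \o G),
      \int[rho]_t (G t)%:E = 0 & \int[rho]_t (G t ^+ 2)%:E = s%:E]%E.

Lemma integrable_of_sqr {d} {T : measurableType d} (rho : probability T R) (G : T -> R) :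
  measurable_fun setT G -> (\int[rho]_t (G t ^+ 2)%:E < +oo)%E ->
  rho.-integrable setT (fun t => (G t ^+ 2)%:E) /\ rho.-integrable setT (EFin \o G).
Proof.
move=> mG G2.
have i2 : rho.-integrable setT (fun t => (G t ^+ 2)%:E).
  apply/integrableP; split; first exact/measurable_EFinP/measurable_funX.
  by under eq_integral => t _ do rewrite gee0_abs ?lee_fin ?sqr_ge0//.
split => //.
apply: (@le_integrable _ _ _ rho setT measurableT _ (fun t => (1 + G t ^+ 2)%:E)).
- exact/measurable_EFinP.
- move=> t _ /=; rewrite lee_fin (ger0_norm (addr_ge0 _ (sqr_ge0 _)))//.
  have := sqr_ge0 (`|G t| - 1); rewrite sqrrB real_normK ?num_real//; nra.
- have i1 : rho.-integrable setT (EFin \o cst 1) by exact: finite_measure_integrable_cst.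
  exact: (integrableD measurableT i1 i2).
Qed.

Lemma centered_shift {d} {T : measurableType d} (rho : probability T R) (G : T -> R) s y :
  centered rho G s -> (\int[rho]_t ((y + G t) ^+ 2)%:E = (y ^+ 2 + s)%:E)%E.
Proof.
move=> [mG iG G0 G2].
have [i2 _] : rho.-integrable setT (fun t => (G t ^+ 2)%:E) /\
    rho.-integrable setT (EFin \o G).
  by apply: integrable_of_sqr => //; rewrite G2 ltry.
have iy : rho.-integrable setT (EFin \o cst (y ^+ 2)) by exact: finite_measure_integrable_cst.
have iyG : rho.-integrable setT (fun t => ((y *+ 2)%:E * (G t)%:E)%E) by exact: integrableZl.
under eq_integral => t _ do rewrite sqrrD -mulrnAl 2!EFinD EFinM.
rewrite integralD//; last exact: (integrableD measurableT iy iyG).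
rewrite (integralD measurableT iy iyG) integralZl//.
rewrite integral_cst_prob G2 [X in (_ * X)%E]G0.
by rewrite mule0 adde0 EFinD.
Qed.

(** Letting [G] vary with i covers both normalized sums (constant [G]) and Gaussian combinations
    (one weight per coordinate). *)
Lemma iid_moment2 {d d'} {Om : measurableType d} {T : measurableType d'}
  (P : probability Om R) (rho : probability T R) (xi : nat -> Om -> T)
  (G : nat -> T -> R) (s : nat -> R) n x :
  iid_seq P rho xi -> (forall i, centered rho (G i) (s i)) ->
  (\int[P]_w ((x + \sum_(i < n) G i (xi i w)) ^+ 2)%:E =
    (x ^+ 2 + \sum_(i < n) s i)%:E)%E.
Proof.
move=> iid cG; have mG i : measurable_fun setT (G i) by case: (cG i).
elim: n => [|n IH].
  under eq_integral do rewrite big_ord0 addr0.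
  by rewrite integral_cst_prob big_ord0 addr0.
under eq_integral do rewrite big_ord_recr/= addrA.
rewrite (iid_integral iid (H := fun w => x + \sum_(i < n) G i (xi i w))
  (F := fun z => ((z.1 + G n z.2) ^+ 2)%:E))//.
- under eq_integral => w _ do rewrite (centered_shift _ (cG n)) EFinD.
  have s0 : 0 <= s n.
    by rewrite -lee_fin; case: (cG n) => _ _ _ <-; apply: integral_ge0 => t _; rewrite lee_fin sqr_ge0.
  rewrite ge0_integralD//.
  + by rewrite IH integral_cst_prob big_ord_recr/= addrA EFinD.
  + by move=> w _; rewrite lee_fin sqr_ge0.
  + by apply/measurable_EFinP/measurable_funX; exact: (measurable_iid_sum iid).
- exact: cyl_sum.
- apply/measurable_EFinP/measurable_funX/measurable_funD => //.
  exact: measurableT_comp.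
- by move=> z; rewrite lee_fin sqr_ge0.
Qed.

End averages.

(** * The standard normal law *)

Section gaussian.
Set Implicit Arguments.
Unset Strict Implicit.
Context {R : realType}.
Implicit Types (phi : R -> R) (C : R).
Notation mu := (@lebesgue_measure R).
Notation gam := (normal_prob (0 : R) 1 : probability (measurableTypeR R) R).

Let one_neq0 : 1 != 0 :> R. Proof. exact: oner_neq0. Qed.

(** The Radon-Nikodym derivative of [normal_prob] and its density have the same integral over every
    measurable set, so they agree almost everywhere. *)
Lemma ge0_integral_gauss (f : R -> \bar R) :
  measurable_fun setT f -> (forall x, 0 <= f x)%E ->
  (\int[gam]_x f x = \int[mu]_x (f x * (normal_pdf 0 1 x)%:E))%E.
Proof.
move=> mf f0; have dom := normal_prob_dominates (0 : R) 1.
rewrite -(Radon_Nikodym_SigmaFinite.change_of_variables dom f0 measurableT mf).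
have iRN := Radon_Nikodym_SigmaFinite.f_integrable dom.
apply: ae_eq_integral => //.
- by apply: emeasurable_funM => //; exact: measurable_int iRN.
- by apply: emeasurable_funM => //; apply: measurableT_comp => //; exact: measurable_normal_pdf.
- apply: ae_eqe_mul2l; apply: integral_ae_eq => //.
  + by apply: measurableT_comp => //; exact: measurable_normal_pdf.
  + by move=> E _ mE; rewrite -Radon_Nikodym_SigmaFinite.f_integral.
Qed.

Lemma ge0_integralT_opp (f : R -> \bar R) :
  measurable_fun setT f -> (forall x, 0 <= f x)%E ->
  (\int[mu]_x f x = \int[mu]_x f (- x)%R)%E.
Proof.
move=> mf f0.
transitivity (\int[pushforward mu (-%R : _ -> measurableTypeR R)]_x f x)%E.
  by apply: eq_measure_integral => A mA _; exact/esym/lebesgue_measureN.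
by rewrite ge0_integral_pushforward.
Qed.

Lemma normal_peakM (b : R) : 0 < b -> b * normal_peak b = normal_peak 1.
Proof.
move=> b0; rewrite /normal_peak -!mulrnAr expr1n mul1r (sqrtrM _ (sqr_ge0 b)).
by rewrite sqrtr_sqr gtr0_norm// invfM mulrA divff ?gt_eqF// mul1r.
Qed.

(** Substitution u = m + b z, increasing since b > 0; the Jacobian b is absorbed by the peak of the
    density ([normal_peakM]). *)
Lemma ge0_integral_gauss_affine (f : R -> R) (m b : R) : 0 < b ->
  continuous f -> (forall x, 0 <= f x) ->
  (\int[gam]_z (f (m + b * z))%:E = \int[mu]_u (f u * normal_pdf m b u)%:E)%E.
Proof.
move=> b0 cf f0; have bN0 : b != 0 by rewrite gt_eqF.
have mf : measurable_fun setT f by exact: continuous_measurable_fun.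
rewrite ge0_integral_gauss; last 2 first.
- apply/measurable_EFinP; apply: measurableT_comp => //.
  by apply: measurable_funD => //; exact: measurable_funM.
- by move=> x; rewrite lee_fin.
have D (x : R) : is_derive x 1 (fun z : R => m + b * z) b.
  have := is_deriveD (is_derive_cst m x 1) (is_deriveZ b (is_derive_id x 1)).
  by rewrite add0r /GRing.scale/= mulr1.
have DE : (fun z : R => m + b * z)^`()%classic = cst b.
  by apply/funext => x; rewrite derive1E; exact: derive_val.
rewrite (@increasing_ge0_integration_by_substitutionT _ (fun z => m + b * z)
  (fun u => f u * normal_pdf m b u)) ?DE//.
- apply: eq_integral => z _ /=; rewrite -EFinM; congr (_%:E).
  rewrite /= [in RHS]/GRing.mul/= -mulrA; congr (_ * _).
  rewrite !normal_pdfE// [RHS]mulrAC [_ * b]mulrC normal_peakM//; congr (_ * _).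
  rewrite /normal_fun; congr expR; rewrite subr0 addrAC subrr add0r expr1n.
  by rewrite exprMn; field.
- by move=> x y xy; rewrite ltrD2l ltr_pM2l.
- by move=> x; exact: cvg_cst.
- exact: is_cvg_cst.
- exact: is_cvg_cst.
- apply: (cvg_comp (fun x => b * x) (fun r => m + r)); last exact: cvg_addrl_Ny.
  by apply: gt0_cvgMrNy => //; exact: cvg_id.
- apply: (cvg_comp (fun x => b * x) (fun r => m + r)); last exact: cvg_addrl.
  by apply: gt0_cvgMry => //; exact: cvg_id.
- move=> x; apply: cvgM; first exact: cf.
  exact: continuous_normal_pdf.
- by move=> x; rewrite mulr_ge0// normal_pdf_ge0.
Qed.

(* For (z, w) standard normal in the plane and u = a w + b z, these are the two ways of
   disintegrating the law of (u, w). *)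
Lemma normal_pdf_swap (a b u w : R) : b != 0 -> a ^+ 2 + b ^+ 2 = 1 ->
  normal_pdf (a * w) b u * normal_pdf 0 1 w = normal_pdf 0 1 u * normal_pdf (a * u) b w.
Proof.
move=> b0 ab; rewrite !normal_pdfE//.
rewrite mulrACA [RHS]mulrACA [normal_peak b * _]mulrC; congr (_ * _).
rewrite /normal_fun -!expRD; congr expR; rewrite !subr0 expr1n.
have key : (u - a * w) ^+ 2 + b ^+ 2 * w ^+ 2 = b ^+ 2 * u ^+ 2 + (w - a * u) ^+ 2.
  apply/eqP; rewrite -subr_eq0; apply/eqP.
  transitivity ((a ^+ 2 + b ^+ 2 - 1) * (w ^+ 2 - u ^+ 2)); first by ring.
  by rewrite ab subrr mul0r.
transitivity (- ((u - a * w) ^+ 2 + b ^+ 2 * w ^+ 2) / (b ^+ 2 *+ 2)); first by field.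
by rewrite key; field.
Qed.

Definition gauss_avg (s : R) phi : R -> R := avg gam (fun z => s * z) phi.

Lemma gauss_avg0 phi : gauss_avg 0 phi = phi.
Proof.
apply/funext => x; rewrite /gauss_avg /avg.
under eq_Rintegral do rewrite mul0r addr0.
exact: Rintegral_cst_prob.
Qed.

Lemma gauss_avgN C s phi : lip_test C phi -> gauss_avg (- s) phi = gauss_avg s phi.
Proof.
move=> phiC; apply/funext => x; apply: EFin_inj.
have mphi := lip_test_measurable phiC.
have phi0 y : 0 <= phi y by case: phiC => _ /(_ y)/andP[].
have m a : measurable_fun setT (fun z : measurableTypeR R => phi (x + a * z)).
  by apply: measurableT_comp => //; apply: measurable_funD => //; exact: measurable_funM.
rewrite /gauss_avg !(avg_EFin _ _ _ phiC); [|exact: measurable_funM..].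
rewrite !ge0_integral_gauss; last 4 first.
- by apply/measurable_EFinP; exact: m.
- by move=> z; rewrite lee_fin.
- by apply/measurable_EFinP; exact: m.
- by move=> z; rewrite lee_fin.
rewrite ge0_integralT_opp.
- apply: eq_integral => z _; rewrite mulrNN; congr (_ * _%:E)%E.
  by rewrite !normal_pdfE// /normal_fun !subr0 sqrrN.
- apply: emeasurable_funM; first by apply/measurable_EFinP; exact: m.
  by apply: measurableT_comp => //; exact: measurable_normal_pdf.
- by move=> z; rewrite mule_ge0// lee_fin// normal_pdf_ge0.
Qed.

(** Stability of the normal law. Dividing by c puts the weights [al], [be] on the unit circle. The
    law of u = al w + be z is written by conditioning on w; after exchanging the integrals,
    [normal_pdf_swap] shows u standard normal, and w integrates out to 1. *)
Let gauss_avg_addp C a b phi : lip_test C phi -> 0 < b ->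
  gauss_avg a (gauss_avg b phi) = gauss_avg (Num.sqrt (a ^+ 2 + b ^+ 2)) phi.
Proof.
move=> phiC b0; apply/funext => x; apply: EFin_inj.
set c := Num.sqrt _.
have c0 : 0 < c by rewrite sqrtr_gt0 ltr_wpDl ?sqr_ge0// exprn_gt0.
have cN0 : c != 0 by rewrite gt_eqF.
pose al := a / c; pose be := b / c.
have be0 : 0 < be by rewrite divr_gt0.
have beN0 : be != 0 by rewrite gt_eqF.
have ab1 : al ^+ 2 + be ^+ 2 = 1.
  rewrite !expr_div_n -mulrDl sqr_sqrtr ?divff//; last by rewrite addr_ge0// sqr_ge0.
  by rewrite gt_eqF// ltr_wpDl ?sqr_ge0// exprn_gt0.
have mphi := lip_test_measurable phiC.
have phi0 y : 0 <= phi y by case: phiC => _ /(_ y)/andP[].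
have mlin s : measurable_fun setT (fun z : measurableTypeR R => s * z) by exact: measurable_funM.
have phibC := avg_lip gam (mlin b) phiC.
pose f u := phi (x + c * u).
have cf : continuous f.
  move=> u; apply: continuous_comp; last exact: lip_test_continuous phiC _.
  by apply: cvgD; [exact: cvg_cst|apply: cvgM; [exact: cvg_cst|exact: cvg_id]].
have f0 u : 0 <= f u by exact: phi0.
have mf : measurable_fun setT f by exact: continuous_measurable_fun.
have pdf0 m s u : 0 <= normal_pdf m s u :> R by exact: normal_pdf_ge0.
have mpdf : measurable_fun setT (fun z : measurableTypeR R => normal_pdf 0 1 z).
  exact: measurable_normal_pdf.
have mpdf2 : measurable_fun setT
    (fun z : measurableTypeR R * measurableTypeR R => normal_pdf (al * z.1) be z.2).
  under eq_fun do rewrite normal_pdfE//.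
  apply: measurable_funM => //; apply: measurableT_comp => //.
  apply: measurable_funM => //; apply: measurableT_comp => //.
  apply: measurable_funX; apply: measurable_funB => //.
  by apply: measurable_funM => //; exact: measurable_fst.
pose K (z : measurableTypeR R * measurableTypeR R) := (f z.2 * normal_pdf (al * z.1) be z.2)%:E.
have mK : measurable_fun setT K.
  by apply/measurable_EFinP/measurable_funM => //; exact: measurableT_comp.
have K0 z : (0 <= K z)%E by rewrite lee_fin mulr_ge0.
rewrite {1}/gauss_avg (avg_EFin _ _ (mlin a) phibC).
transitivity (\int[gam]_w \int[mu]_u K (w, u))%E.
  apply: eq_integral => w _; rewrite (avg_EFin _ _ (mlin b) phiC).
  transitivity (\int[gam]_z (f (al * w + be * z))%:E)%E; last first.
    exact: ge0_integral_gauss_affine.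
  apply: eq_integral => z _; rewrite /f; congr ((phi _)%:E).
  rewrite -addrA mulrDr !mulrA /al /be; congr (_ + _); congr (_ * _ + _ * _).
    by rewrite mulrAC divff// mul1r.
  by rewrite mulrAC divff// mul1r.
rewrite ge0_integral_gauss; last 2 first.
- exact: measurable_fun_fubini_tonelli_F.
- by move=> w; apply: integral_ge0.
pose L (z : measurableTypeR R * measurableTypeR R) := (K z * (normal_pdf 0 1 z.1)%:E)%E.
transitivity (\int[mu]_w \int[mu]_u L (w, u))%E.
  apply: eq_integral => w _; rewrite /L/= ge0_integralZr//; last by rewrite lee_fin.
  exact: (measurableT_comp mK).
have mL : measurable_fun setT L.
  apply: emeasurable_funM => //; apply/measurable_EFinP.
  by apply: measurableT_comp => //; exact: measurable_fst.
rewrite fubini_tonelli//; last by move=> z; rewrite mule_ge0// lee_fin.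
rewrite /gauss_avg (avg_EFin _ _ (mlin c) phiC) ge0_integral_gauss; last 2 first.
- exact/measurable_EFinP.
- by move=> u; rewrite lee_fin.
apply: eq_integral => u _.
transitivity (\int[mu]_w ((f u * normal_pdf 0 1 u)%:E * (normal_pdf (al * u) be w)%:E))%E.
  apply: eq_integral => w _; rewrite /L /K/= -!EFinM; congr _%:E.
  by rewrite -mulrA (@normal_pdf_swap al be u w beN0 ab1) mulrA.
rewrite ge0_integralZl//.
- by rewrite integral_normal_pdf mule1 EFinM.
- by apply/measurable_EFinP; exact: measurable_normal_pdf.
- by move=> w _; rewrite lee_fin.
- by rewrite lee_fin mulr_ge0.
Qed.

Lemma gauss_avg_add C a b phi : lip_test C phi ->
  gauss_avg a (gauss_avg b phi) = gauss_avg (Num.sqrt (a ^+ 2 + b ^+ 2)) phi.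
Proof.
move=> phiC; have [b0|b0|<-] := ltrgtP 0 b.
- exact: gauss_avg_addp phiC _.
- by rewrite -(gauss_avgN b phiC) (gauss_avg_addp _ phiC) ?oppr_gt0// sqrrN.
- rewrite gauss_avg0 expr0n addr0 sqrtr_sqr.
  have [a0|a0] := lerP 0 a; first by rewrite ger0_norm.
  by rewrite ltr0_norm// (gauss_avgN a phiC).
Qed.

Lemma gauss_avg_lip C s phi : lip_test C phi -> lip_test C (gauss_avg s phi).
Proof. by move=> phiC; apply: avg_lip => //; exact: measurable_funM. Qed.

Let q (z : R) : R := normal_pdf 0 1 z.

Let qE : q = (fun z => normal_peak 1 * expR (- z ^+ 2 / 2)).
Proof. by rewrite /q normal_pdfE//; apply/funext => z; rewrite /normal_fun subr0 expr1n. Qed.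

Let dq (z : R) : is_derive z 1 q (- z * q z).
Proof.
have d2 : is_derive z 1 (fun z : R => - z ^+ 2 / 2) (- z).
  have -> : (fun z : R => - z ^+ 2 / 2) = ((- 2^-1) *: ((@id R) ^+ 2)).
    by apply/funext => y; rewrite !fctE /GRing.scale/=; field.
  apply: is_derive_eq; rewrite /GRing.scale/= expr1 mulr1.
  by rewrite -mulr_natr; field.
have H := is_deriveZ (normal_peak 1 : R) (is_derive1_comp (is_derive_expR _) d2).
have <- : normal_peak 1 *: (expR (- z ^+ 2 / 2) * - z) = - z * q z.
  by rewrite qE /GRing.scale/=; ring.
by rewrite qE; exact: H.
Qed.

Let dF (z : R) : is_derive z 1 (fun z => z * q z) ((1 - z ^+ 2) * q z).
Proof.
have H := is_deriveM (is_derive_id z 1) (dq z).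
have <- : z *: (- z * q z) + (q z)%:A = (1 - z ^+ 2) * q z.
  by rewrite /GRing.scale/=; ring.
exact: H.
Qed.

Let cq : continuous q. Proof. exact: continuous_normal_pdf. Qed.

Let q0 z : 0 <= q z. Proof. exact: normal_pdf_ge0. Qed.

Let csq : continuous (fun z : R => z ^+ 2). Proof. exact: sqr_continuous. Qed.

Let c1sq : continuous (fun z : R => (1 - z ^+ 2) * q z).
Proof.
by move=> z; apply: cvgM; [apply: cvgB; [exact: cvg_cst|exact: csq]|exact: cq].
Qed.

Let csq1 : continuous (fun z : R => (z ^+ 2 - 1) * q z).
Proof.
by move=> z; apply: cvgM; [apply: cvgB; [exact: csq|exact: cvg_cst]|exact: cq].
Qed.

Let cF : continuous (fun z : R => z * q z).
Proof. by move=> z; apply: cvgM; [exact: cvg_id|exact: cq]. Qed.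

(* z q(z) has derivative (1 - z^2) q(z); the integrals of (1 - z^2) q over [0, 1] and of
   (z^2 - 1) q over [1, +oo[ are both q(1), hence z^2 q and q have the same integral. *)
Let int01 : (\int[mu]_(z in `[0%R, 1%R]) ((1 - z ^+ 2) * q z)%:E = (q 1)%:E)%E.
Proof.
rewrite (@continuous_FTC2 _ _ (fun z => z * q z))//.
- by rewrite mul0r sube0 mul1r.
- exact: continuous_subspaceT.
- split.
  + by move=> x _; have := dF x => -[].
  + by apply: cvg_at_right_filter; exact: cF.
  + by apply: cvg_at_left_filter; exact: cF.
- by move=> x _; rewrite derive1E; apply: derive_val.
Qed.

Let cvgF : (- (z * q z)) @[z --> +oo] --> (0 : R).
Proof.
rewrite -oppr0; apply: cvgN.
apply/cvgrPdist_le => e e0; near=> z.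
have z0 : 0 < z by near: z; exact: nbhs_pinfty_gt.
have ze : normal_peak 1 *+ 2 / e <= z by near: z; apply: nbhs_pinfty_ge; exact: num_real.
rewrite sub0r normrN ger0_norm; last by rewrite mulr_ge0// ltW.
have p0 : 0 <= normal_peak 1 :> R by exact: normal_peak_ge0.
(* From e^x >= 1 + x >= x at x = z^2 / 2. It bounds z q(z) by twice the peak over z, whence the
   threshold imposed on z above. *)
have h : expR (- z ^+ 2 / 2) <= 2 / z ^+ 2.
  rewrite mulNr expRN -[leRHS]invf_div lef_pV2 ?posrE ?expR_gt0//; last by rewrite divr_gt0// exprn_gt0.
  by rewrite (le_trans _ (expR_ge1Dx _))// lerDr.
rewrite qE (@le_trans _ _ (z * (normal_peak 1 * (2 / z ^+ 2))))//.
  by rewrite ler_wpM2l ?(ltW z0)// ler_wpM2l.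
have -> : z * (normal_peak 1 * (2 / z ^+ 2)) = normal_peak 1 *+ 2 / z.
  by rewrite -mulr_natr; field; rewrite gt_eqF.
by rewrite ler_pdivrMr// mulrC -ler_pdivrMr.
Unshelve. all: by end_near. Qed.

Let sqr_ge1 (z : R) : 1 <= z -> 0 <= z ^+ 2 - 1. Proof. by move=> z1; nra. Qed.

Let sqr_le1 (z : R) : 0 <= z -> z <= 1 -> 0 <= 1 - z ^+ 2.
Proof. by move=> z0 z1; nra. Qed.

Let int1y : (\int[mu]_(z in `[1%R, +oo[) ((z ^+ 2 - 1) * q z)%:E = (q 1)%:E)%E.
Proof.
rewrite (@ge0_continuous_FTC2y _ _ (fun z => - (z * q z)) _ 0)//.
- by rewrite sub0e mul1r -EFinN opprK.
- by move=> x x1; rewrite mulr_ge0//; exact: sqr_ge1.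
- exact: continuous_subspaceT.
- by move=> x _; apply: derivableN; have := dF x => -[].
- by apply: cvg_at_right_filter; apply: cvgN; exact: cF.
- move=> x _; rewrite derive1E deriveN; last by have := dF x => -[].
  by rewrite [X in - X](@derive_val _ _ _ _ _ _ _ (dF x)); ring.
Qed.

Let int0y : (\int[mu]_(z in [set z : R | 0 <= z]%R) (z ^+ 2 * q z)%:E =
  \int[mu]_(z in [set z : R | 0 <= z]%R) (q z)%:E)%E.
Proof.
have mf (f : R -> R) D : continuous f -> measurable_fun D (EFin \o f).
  move=> cf; apply/measurable_EFinP; apply: measurable_funTS.
  exact: continuous_measurable_fun.
have csqq : continuous (fun z : R => z ^+ 2 * q z).
  by move=> z; apply: cvgM; [exact: csq|exact: cq].
have sq0 z : 0 <= z ^+ 2 * q z by rewrite mulr_ge0// sqr_ge0.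
(* Cutting at 1 keeps 1 - z^2 and z^2 - 1 nonnegative on their respective pieces, so that only
   integrals of nonnegative functions are ever added. *)
have split (f : R -> R) : continuous f -> (forall z, 0 <= f z) ->
   (\int[mu]_(z in [set z : R | 0 <= z]%R) (f z)%:E =
    \int[mu]_(z in `[0%R, 1%R]) (f z)%:E + \int[mu]_(z in `[1%R, +oo[) (f z)%:E)%E.
  move=> cf f0; rewrite -set_itvcy (@itv_bndbnd_setU _ _ _ (BRight 1)) ?bnd_simp ?ler01//.
  rewrite ge0_integral_setU//.
  - by rewrite integral_itv_obnd_cbnd//; exact: mf.
  - exact: mf.
  - by move=> z _; rewrite lee_fin.
  - by apply/disj_setPRL => z /=; rewrite !in_itv/= andbT => z1 /andP[_]; rewrite leNgt z1.
rewrite (split _ csqq sq0) (split _ cq q0).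
have -> : (\int[mu]_(z in `[0%R, 1%R]) (q z)%:E =
   \int[mu]_(z in `[0%R, 1%R]) (z ^+ 2 * q z)%:E + (q 1)%:E)%E.
  rewrite -int01 -ge0_integralD//.
  - by apply: eq_integral => z _; rewrite -EFinD -mulrDl addrC subrK mul1r.
  - by move=> z _; rewrite lee_fin.
  - exact: mf.
  - move=> z /=; rewrite in_itv/= => /andP[z0 z1]; rewrite lee_fin mulr_ge0//.
    exact: sqr_le1.
  - exact: mf.
have -> : (\int[mu]_(z in `[1%R, +oo[) (z ^+ 2 * q z)%:E =
   (q 1)%:E + \int[mu]_(z in `[1%R, +oo[) (q z)%:E)%E.
  rewrite -int1y -ge0_integralD//.
  - by apply: eq_integral => z _; rewrite -EFinD mulrBl mul1r subrK.
  - move=> z /=; rewrite in_itv/= andbT => z1; rewrite lee_fin mulr_ge0//.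
    exact: sqr_ge1.
  - exact: mf.
  - by move=> z _; rewrite lee_fin.
  - exact: mf.
by rewrite addeA.
Qed.

Lemma gauss_moment2 : (\int[gam]_z (z ^+ 2)%:E = 1)%E.
Proof.
rewrite ge0_integral_gauss; last 2 first.
- by apply/measurable_EFinP; apply: measurable_funX.
- by move=> x; rewrite lee_fin sqr_ge0.
have q_even : q =1 q \o -%R.
  by move=> z; rewrite /q/= !normal_pdfE// /normal_fun !subr0 sqrrN.
transitivity (\int[mu]_z (z ^+ 2 * q z)%:E)%E.
  by apply: eq_integral => z _; rewrite EFinM.
rewrite ge0_symfun_integralT.
- by rewrite int0y -ge0_symfun_integralT// integral_normal_pdf.
- by move=> z; rewrite mulr_ge0// sqr_ge0.
- by move=> z; apply: cvgM; [exact: csq|exact: cq].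
- by move=> z; rewrite /= sqrrN q_even.
Qed.

Lemma ge0_integral_gauss_opp (f : R -> \bar R) :
  measurable_fun setT f -> (forall x, 0 <= f x)%E ->
  (\int[gam]_x f x = \int[gam]_x f (- x)%R)%E.
Proof.
move=> mf f0.
have mf' : measurable_fun setT (fun x : R => f (- x)) by exact: measurableT_comp.
rewrite ge0_integral_gauss// (@ge0_integral_gauss (fun x => f (- x)))//.
rewrite ge0_integralT_opp.
- apply: eq_integral => z _; congr (_ * _%:E)%E.
  by rewrite !normal_pdfE// /normal_fun !subr0 sqrrN.
- apply: emeasurable_funM => //.
  by apply: measurableT_comp => //; exact: measurable_normal_pdf.
- by move=> z; rewrite mule_ge0// lee_fin// normal_pdf_ge0.
Qed.

Lemma gauss_centered : centered gam (fun z : measurableTypeR R => (z : R)) 1.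
Proof.
have mid : measurable_fun setT (fun z : measurableTypeR R => (z : R)) by exact: measurable_id.
have [_ i1] : gam.-integrable setT (fun t : R => (t ^+ 2)%:E) /\ gam.-integrable setT (EFin \o id).
  by apply: integrable_of_sqr => //; rewrite gauss_moment2 ltry.
split => //; last exact: gauss_moment2.
(* By symmetry the positive and the negative part of z have the same integral, which is finite by
   [i1]. *)
rewrite integralE ge0_integral_gauss_opp.
- rewrite [X in (X - _)%E](_ : _ = \int[gam]_x (EFin \o id)^\- x)%E.
    by rewrite subee//; exact: (integrable_neg_fin_num measurableT i1).
  apply: eq_integral => z _; rewrite funeposE funenegE/=.
  by rewrite EFinN.
- exact: measurable_funepos.
- by move=> z; exact: funepos_ge0.
Qed.

Lemma centered_scale {d} {T : measurableType d} (rho : probability T R) (G : T -> R) s c :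
  centered rho G s -> centered rho (fun t => c * G t) (c ^+ 2 * s).
Proof.
move=> [mG iG G0 G2].
have [i2 _] : rho.-integrable setT (fun t => (G t ^+ 2)%:E) /\
    rho.-integrable setT (EFin \o G).
  by apply: integrable_of_sqr => //; rewrite G2 ltry.
split.
- exact: measurable_funM.
- by have := integrableZl measurableT c iG.
- under eq_integral do rewrite EFinM.
  by rewrite integralZl// [X in (_ * X)%E]G0 mule0.
- under eq_integral do rewrite exprMn EFinM.
  by rewrite integralZl// G2 EFinM.
Qed.

End gaussian.

(** * Lindeberg's method *)

Section lindeberg.
Set Implicit Arguments.
Unset Strict Implicit.
Context {R : realType}.
Implicit Types (phi : R -> R) (C : R).
Notation gam := (normal_prob (0 : R) 1 : probability (measurableTypeR R) R).

(** The square gives integrability under a second moment, the cube gives smallness after scaling. *)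
Definition rem3 (h : R) := Num.min (h ^+ 2) (`|h| ^+ 3).

(** [d1] and [d2] stand for phi'(x) and phi''(x)/2. Their values never matter: the first multiplies
    a zero mean, the second cancels between two laws of equal variance. C does not depend on x. *)
Definition smooth_test C phi := lip_test C phi /\
  forall x, exists d1 d2, forall h,
    `|phi (x + h) - phi x - d1 * h - d2 * h ^+ 2| <= C * rem3 h.

Lemma rem3_ge0 h : 0 <= rem3 h.
Proof. by rewrite /rem3 le_min sqr_ge0 exprn_ge0. Qed.

Lemma rem3_le_sqr h : rem3 h <= h ^+ 2.
Proof. by rewrite /rem3 ge_min lexx. Qed.

Section rem3_integral.
Context {d} {T : measurableType d} (rho : probability T R).

Lemma measurable_rem3 (G : T -> R) : measurable_fun setT G ->
  measurable_fun setT (fun t => rem3 (G t)).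
Proof.
move=> mG; apply: measurable_minr; first exact: measurable_funX.
by apply: measurable_funX; exact: measurableT_comp.
Qed.

Lemma integrable_rem3 (G : T -> R) s : centered rho G s ->
  rho.-integrable setT (fun t => (rem3 (G t))%:E).
Proof.
move=> [mG _ _ G2].
have [i2 _] : rho.-integrable setT (fun t => (G t ^+ 2)%:E) /\
    rho.-integrable setT (EFin \o G).
  by apply: integrable_of_sqr => //; rewrite G2 ltry.
apply: le_integrable i2 => //.
- exact/measurable_EFinP/measurable_rem3.
- move=> t _ /=; rewrite lee_fin (ger0_norm (rem3_ge0 _)) ger0_norm ?sqr_ge0//.
  exact: rem3_le_sqr.
Qed.

Lemma avg_taylor C phi (G : T -> R) s x d1 d2 : lip_test C phi -> centered rho G s ->
  (forall h, `|phi (x + h) - phi x - d1 * h - d2 * h ^+ 2| <= C * rem3 h) ->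
  `|avg rho G phi x - phi x - d2 * s| <= C * \int[rho]_t rem3 (G t).
Proof.
move=> phiC cG tay; have [mG iG G0 G2] := cG.
have ir := integrable_rem3 cG.
have [i2 _] : rho.-integrable setT (fun t => (G t ^+ 2)%:E) /\
    rho.-integrable setT (EFin \o G).
  by apply: integrable_of_sqr => //; rewrite G2 ltry.
have mxG : measurable_fun setT (fun t => x + G t) by exact: measurable_funD.
have i0 := test_comp_integrable rho phiC mxG.
have ic : rho.-integrable setT (EFin \o (fun=> phi x)) by exact: finite_measure_integrable_cst.
have i0c : rho.-integrable setT (EFin \o (fun t => phi (x + G t) - phi x)).
  exact: (integrableB measurableT i0 ic).
have i1' : rho.-integrable setT (EFin \o (fun t => d1 * G t)) by have := integrableZl measurableT d1 iG.
have i2' : rho.-integrable setT (EFin \o (fun t => d2 * G t ^+ 2)) by have := integrableZl measurableT d2 i2.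
have i01 : rho.-integrable setT (EFin \o (fun t => phi (x + G t) - phi x - d1 * G t)).
  exact: (integrableB measurableT i0c i1').
have i012 : rho.-integrable setT
    (EFin \o (fun t => phi (x + G t) - phi x - d1 * G t - d2 * G t ^+ 2)).
  exact: (integrableB measurableT i01 i2').
have -> : avg rho G phi x - phi x - d2 * s =
    \int[rho]_t (phi (x + G t) - phi x - d1 * G t - d2 * G t ^+ 2).
  rewrite RintegralB// RintegralB// RintegralB// Rintegral_cst_prob.
  rewrite !RintegralZl//.
  have -> : \int[rho]_t G t = 0 by rewrite /Rintegral G0.
  have -> : \int[rho]_t (G t ^+ 2) = s by rewrite /Rintegral G2.
  by rewrite mulr0 subr0.
apply: le_trans (le_normr_Rintegral _ _) _ => //.
rewrite -RintegralZl//; apply: le_Rintegral => //.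
- exact: (integrable_norm i012).
- by have := integrableZl measurableT C ir.
Qed.

Lemma avg_contract C C' phi psi (G : T -> R) e : measurable_fun setT G ->
  lip_test C phi -> lip_test C' psi -> (forall x, `|phi x - psi x| <= e) ->
  forall x, `|avg rho G phi x - avg rho G psi x| <= e.
Proof.
move=> mG phiC psiC pp x.
have mxG : measurable_fun setT (fun t => x + G t) by exact: measurable_funD.
have i1 := test_comp_integrable rho phiC mxG.
have i2 := test_comp_integrable rho psiC mxG.
rewrite /avg -RintegralB//.
have iB : rho.-integrable setT (EFin \o (fun t => phi (x + G t) - psi (x + G t))).
  exact: (integrableB measurableT i1 i2).
apply: le_trans (le_normr_Rintegral _ _) _ => //.
rewrite -[leRHS](Rintegral_cst_prob rho); apply: le_Rintegral => //.
- exact: (integrable_norm iB).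
- exact: finite_measure_integrable_cst.
Qed.

Lemma avgs_contract C C' phi psi (G : nat -> T -> R) n e :
  (forall i, measurable_fun setT (G i)) ->
  lip_test C phi -> lip_test C' psi -> (forall x, `|phi x - psi x| <= e) ->
  forall x, `|avgs rho G n phi x - avgs rho G n psi x| <= e.
Proof.
move=> mG; elim: n phi psi => [//|n IH] phi psi phiC psiC pp /=.
apply: IH; [exact: avg_lip|exact: avg_lip|].
exact: avg_contract phiC psiC pp.
Qed.

End rem3_integral.

(* The averaging operators commute and are contractions, so the one-step error for phi
   also bounds the one-step error for all its Gaussian averages. *)
Lemma avgs_gauss_close {d} {T : measurableType d} (rho : probability T R)
    (G : T -> R) C phi e s n :
  measurable_fun setT G -> lip_test C phi ->
  (forall x, `|avg rho G phi x - gauss_avg s phi x| <= e) ->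
  forall x, `|avgs rho (fun=> G) n phi x - iter n (gauss_avg s) phi x| <= n%:R * e.
Proof.
move=> mG; have ms : measurable_fun setT (fun z : measurableTypeR R => s * z).
  exact: measurable_funM.
elim: n phi => [|n IH] phi phiC Ge x; first by rewrite /= subrr normr0 mul0r.
rewrite iterSr /=.
rewrite -(subrKA (avgs rho (fun=> G) n (gauss_avg s phi) x)).
apply: le_trans (ler_normD _ _) _.
rewrite -natr1 mulrDl mul1r addrC lerD//.
- apply: IH; first exact: gauss_avg_lip.
  move=> y; rewrite /gauss_avg (avg_comm rho gam mG ms phiC).
  apply: (avg_contract gam ms (avg_lip rho mG phiC) (gauss_avg_lip s phiC)).
  exact: Ge.
- exact: avgs_contract (avg_lip rho mG phiC) (gauss_avg_lip s phiC) Ge x.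
Qed.

Lemma iter_gauss_avg C phi s n : lip_test C phi ->
  iter n (gauss_avg s) phi = gauss_avg (Num.sqrt (n%:R * s ^+ 2)) phi.
Proof.
move=> phiC; elim: n => [|n IH]; first by rewrite mul0r sqrtr0 gauss_avg0.
rewrite iterS IH (gauss_avg_add _ _ phiC) sqr_sqrtr; last by rewrite mulr_ge0// sqr_ge0.
by rewrite -{1}[s ^+ 2]mul1r -mulrDl nat1r.
Qed.

(** By stability ([iter_gauss_avg]) the limit is itself an n-fold average with steps of variance
    v/n. A step of the sum and a Gaussian step share mean and variance, so both are compared with
    the common value phi(x) + d2 v/n, and each of the n exchanges costs two remainders. *)
Lemma clt_bound {d d'} {Om : measurableType d} {T : measurableType d'}
    (P : probability Om R) (rho : probability T R) (xi : nat -> Om -> T)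
    (G : T -> R) v C phi n :
  iid_seq P rho xi -> smooth_test C phi -> centered rho G v -> (0 < n)%N ->
  `|\int[P]_w phi ((Num.sqrt n%:R)^-1 * \sum_(i < n) G (xi i w)) - gauss_avg (Num.sqrt v) phi 0|
  <= C * (n%:R * \int[rho]_t rem3 ((Num.sqrt n%:R)^-1 * G t) +
          n%:R * \int[gam]_z rem3 ((Num.sqrt n%:R)^-1 * (Num.sqrt v * z))).
Proof.
move=> iid [phiC tay] cG n0; set r := (Num.sqrt n%:R)^-1; have [mG _ _ G2] := cG.
have v0 : 0 <= v.
  by rewrite -lee_fin -G2; apply: integral_ge0 => t _; rewrite lee_fin sqr_ge0.
have n0R : 0 < n%:R :> R by rewrite ltr0n.
have r2 : r ^+ 2 = n%:R^-1 by rewrite /r exprVn sqr_sqrtr// ltW.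
have mrG : measurable_fun setT (fun t => r * G t) by exact: measurable_funM.
have -> : \int[P]_w phi (r * \sum_(i < n) G (xi i w)) = avgs rho (fun _ t => r * G t) n phi 0.
  rewrite -(iid_avgs iid _ _ _ phiC)//.
  by apply: eq_Rintegral => w _; rewrite add0r mulr_sumr.
pose s := r * Num.sqrt v.
have -> : gauss_avg (Num.sqrt v) phi = iter n (gauss_avg s) phi.
  rewrite (iter_gauss_avg _ _ phiC); congr (gauss_avg (Num.sqrt _) phi).
  by rewrite exprMn r2 sqr_sqrtr// mulrA divff ?gt_eqF// mul1r.
rewrite -mulrDr mulrCA; apply: (avgs_gauss_close (C := C)) => // x.
have [d1 [d2 tx]] := tay x.
have crG := centered_scale r cG.
have cs : centered gam (fun z : measurableTypeR R => r * (Num.sqrt v * z)) (r ^+ 2 * v).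
  rewrite -[v in r ^+ 2 * v]sqr_sqrtr// -[Num.sqrt v ^+ 2]mulr1.
  exact/centered_scale/centered_scale/gauss_centered.
have -> : gauss_avg s phi x = avg gam (fun z => r * (Num.sqrt v * z)) phi x.
  by apply: eq_Rintegral => z _; rewrite mulrA.
have h1 := avg_taylor phiC crG tx; have h2 := avg_taylor phiC cs tx.
rewrite -(subrKA (phi x + d2 * (r ^+ 2 * v))) mulrDr.
apply: le_trans (ler_normD _ _) _; apply: lerD; first by rewrite opprD addrA.
by rewrite distrC opprD addrA.
Qed.

(** The Lindeberg condition. The quantity n rem3(G/sqrt(n)) is at most min((A g)^2, (A
    g)^3/sqrt(n)), which tends to 0 pointwise and is dominated by (A g)^2. This bound sees G only
    through its envelope A g, so one N serves all such G. *)
Lemma rem3_small {d} {T : measurableType d} (rho : probability T R) (g : T -> R) A e :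
  measurable_fun setT g -> (forall t, 0 <= g t) ->
  rho.-integrable setT (fun t => (g t ^+ 2)%:E) -> 0 <= A -> 0 < e ->
  exists N, forall n, (N <= n)%N -> (0 < n)%N -> forall G : T -> R, measurable_fun setT G ->
    (forall t, `|G t| <= A * g t) ->
    n%:R * \int[rho]_t rem3 ((Num.sqrt n%:R)^-1 * G t) <= e.
Proof.
move=> mg g0 ig A0 e0.
pose b n t := Num.min ((A * g t) ^+ 2) ((A * g t) ^+ 3 * (Num.sqrt n%:R)^-1).
have mb n : measurable_fun setT (b n).
  apply: measurable_minr; first by apply: measurable_funX; exact: measurable_funM.
  by apply: measurable_funM => //; apply: measurable_funX; exact: measurable_funM.
have b0 n t : 0 <= b n t.
  by rewrite le_min !mulr_ge0// ?exprn_ge0 ?invr_ge0// mulr_ge0.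
have iAg : rho.-integrable setT (fun t => ((A * g t) ^+ 2)%:E).
  by under eq_fun do rewrite exprMn EFinM; exact: integrableZl.
have ble n t : b n t <= (A * g t) ^+ 2 by rewrite ge_min lexx.
have ib n : rho.-integrable setT (EFin \o b n).
  apply: le_integrable iAg => //; first exact/measurable_EFinP.
  by move=> t _ /=; rewrite lee_fin !ger0_norm// sqr_ge0.
have sqrt_y : (Num.sqrt n%:R : R)^-1 @[n --> \oo] --> 0.
  apply/cvgrPdist_le => y y0; near=> n.
  have ny : y ^- 2 <= n%:R by near: n; exact: nbhs_infty_ger.
  have n0 : 0 < n%:R :> R by apply: lt_le_trans ny; rewrite invr_gt0 exprn_gt0.
  rewrite sub0r normrN ger0_norm ?invr_ge0// -[leRHS]invrK lef_pV2 ?posrE ?sqrtr_gt0 ?invr_gt0//.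
  by rewrite -[leLHS]gtr0_norm ?invr_gt0// -sqrtr_sqr ler_wsqrtr// exprVn.
have bto0 t : (b n t)%:E @[n --> \oo] --> 0%E.
  apply/fine_cvgP; split; first exact: nearW.
  apply: (@squeeze_cvgr _ _ _ _ (cst 0) (fun n => (A * g t) ^+ 3 * (Num.sqrt n%:R)^-1)).
  - by apply: nearW => n /=; rewrite b0 /b ge_min lexx orbT.
  - exact: cvg_cst.
  - by rewrite -[X in _ --> X](mulr0 ((A * g t) ^+ 3)); apply: cvgM => //; exact: cvg_cst.
have dom t n : setT t -> (`|(b n t)%:E| <= ((A * g t) ^+ 2)%:E)%E.
  by move=> _; rewrite /= lee_fin ger0_norm.
have [_ _] := @dominated_convergence _ _ _ rho setT measurableT (fun n t => (b n t)%:E)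
  (cst 0%E) (fun t => ((A * g t) ^+ 2)%:E) (fun n => (measurable_EFinP _ _).2 (mb n))
  (measurable_cst _) (aeW _ (fun t _ => bto0 t)) iAg
  (aeW _ dom).
rewrite integral0 => /fine_cvgP[_ H].
have /cvgrPdist_le/(_ e e0) [N _ HN] := H.
exists N => n Nn n0 G mG GA; have := HN n Nn.
rewrite /= sub0r normrN ger0_norm; last by apply: Rintegral_ge0 => t _; exact: b0.
apply: le_trans.
set r := (Num.sqrt n%:R)^-1.
have n0R : 0 < n%:R :> R by rewrite ltr0n.
have r0 : 0 <= r by rewrite invr_ge0.
have nr2 : n%:R * r ^+ 2 = 1 by rewrite /r exprVn sqr_sqrtr ?(ltW n0R)// divff ?gt_eqF.
have remb t : n%:R * rem3 (r * G t) <= b n t.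
  rewrite /rem3 /b le_min -/r; apply/andP; split.
  - apply: (@le_trans _ _ (n%:R * (r * G t) ^+ 2)).
      by rewrite ler_wpM2l ?(ltW n0R)// ge_min lexx.
    rewrite exprMn mulrA nr2 mul1r -[leLHS]real_normK ?num_real//.
    by rewrite lerXn2r// nnegrE// (le_trans _ (GA t)).
  - apply: (@le_trans _ _ (n%:R * `|r * G t| ^+ 3)).
      by rewrite ler_wpM2l ?(ltW n0R)// ge_min lexx orbT.
    have -> : n%:R * `|r * G t| ^+ 3 = `|G t| ^+ 3 * r.
      rewrite normrM (ger0_norm r0) exprMn.
      transitivity ((n%:R * r ^+ 2) * (`|G t| ^+ 3 * r)); first by ring.
      by rewrite nr2 mul1r.
    by rewrite ler_wpM2r// lerXn2r// nnegrE// (le_trans _ (GA t)).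
have irem : rho.-integrable setT (fun t => (rem3 (r * G t))%:E).
  apply: (le_integrable measurableT _ _ (ib n)).
    by apply/measurable_EFinP/measurable_rem3; exact: measurable_funM.
  move=> t _ /=; rewrite lee_fin !ger0_norm ?rem3_ge0//.
  by apply: le_trans (remb t); rewrite ler_peMl ?rem3_ge0// ler1n.
rewrite -RintegralZl//; apply: le_Rintegral => //.
by have := integrableZl measurableT n%:R irem.
Unshelve. all: by end_near. Qed.

End lindeberg.

(** * Orthonormal systems and a central limit theorem uniform in the coefficients *)

Section clt.
Set Implicit Arguments.
Unset Strict Implicit.
Context {R : realType}.
Notation gam := (normal_prob (0 : R) 1 : probability (measurableTypeR R) R).

(** Restricted to indices below K because for finite M nothing is known of the functions beyond
    M. *)
Definition orthonormal {d} {T : measurableType d} (rho : probability T R)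
    (K : nat) (g : nat -> T -> R) :=
  (forall k, (k < K)%N -> measurable_fun setT (g k) /\ (\int[rho]_t (g k t)%:E = 0)%E) /\
  (forall k l, (k < K)%N -> (l < K)%N ->
     (\int[rho]_t (g k t * g l t)%:E = (k == l)%:R%:E)%E).

Section orthonormal_theory.
Context {d} {T : measurableType d} (rho : probability T R) (K : nat)
  (g : nat -> T -> R) (og : orthonormal rho K g).

Lemma orthonormal_sqr_int (k : 'I_K) :
  rho.-integrable setT (fun t => (g k t ^+ 2)%:E) /\ rho.-integrable setT (EFin \o g k).
Proof.
apply: integrable_of_sqr; first exact: (og.1 _ (ltn_ord k)).1.
by under eq_integral do rewrite expr2; rewrite og.2// ltry.
Qed.

Let int_prod (k l : 'I_K) : rho.-integrable setT (fun t => (g k t * g l t)%:E).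
Proof.
have [ik _] := orthonormal_sqr_int k; have [il _] := orthonormal_sqr_int l.
have mg (j : 'I_K) : measurable_fun setT (g j) by exact: (og.1 _ (ltn_ord j)).1.
apply: (le_integrable measurableT _ _ (integrableD measurableT ik il)).
- exact/measurable_EFinP/measurable_funM.
- move=> t _ /=; rewrite lee_fin [leRHS]ger0_norm ?addr_ge0 ?sqr_ge0// normrM.
  rewrite -[g k t ^+ 2]real_normK ?num_real// -[g l t ^+ 2]real_normK ?num_real//.
  by have := sqr_ge0 (`|g k t| - `|g l t|); nra.
Qed.

Lemma orthonormal_comb (a : nat -> R) :
  centered rho (fun t => \sum_(k < K) a k * g k t) (\sum_(k < K) a k ^+ 2).
Proof.
have mg (j : 'I_K) : measurable_fun setT (g j) by exact: (og.1 _ (ltn_ord j)).1.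
have ia (k : 'I_K) : rho.-integrable setT (fun t => ((a k)%:E * (g k t)%:E)%E).
  by apply: integrableZl => //; exact: (orthonormal_sqr_int k).2.
split.
- by apply: measurable_sum => k; exact: measurable_funM.
- rewrite (_ : EFin \o _ = fun t => \sum_(k < K) ((a k)%:E * (g k t)%:E)%E).
    by apply: integrable_sum.
  by apply/funext => t; rewrite /= -sumEFin.
- under eq_integral => t _ do rewrite -sumEFin.
  rewrite (integral_sum measurableT ia) big1// => k _.
  by rewrite integralZl ?(orthonormal_sqr_int k).2// (og.1 _ (ltn_ord k)).2 mule0.
- have ip (k l : 'I_K) : rho.-integrable setT (fun t => ((a k * a l)%:E * (g k t * g l t)%:E)%E).
    by apply: integrableZl => //; exact: int_prod.
  transitivity (\int[rho]_t \sum_(k < K) \sum_(l < K) ((a k * a l)%:E * (g k t * g l t)%:E))%E.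
    apply: eq_integral => t _; rewrite expr2 big_distrlr/= -sumEFin; apply: eq_bigr => k _.
    by rewrite -sumEFin; apply: eq_bigr => l _; rewrite -EFinM mulrACA.
  rewrite (integral_sum measurableT); last first.
    by move=> k; apply: integrable_sum.
  rewrite -sumEFin; apply: eq_bigr => k _.
  rewrite (integral_sum measurableT)// (bigD1 k)//= big1 ?adde0 => [|l lk].
    by rewrite integralZl// og.2// eqxx mule1 expr2.
  move: lk; rewrite -val_eqE/= eq_sym => /negbTE lk.
  by rewrite integralZl// og.2// lk mule0.
Qed.

(** The sum of the |g_k| is the common envelope, up to the factor A, of all combinations with
    coefficients bounded by A; [rem3_small] needs its square integrable. *)
Lemma orthonormal_abs_sqr_int :
  rho.-integrable setT (fun t => ((\sum_(k < K) `|g k t|) ^+ 2)%:E).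
Proof.
rewrite (_ : (fun t => _) =
    fun t => \sum_(k < K) \sum_(l < K) (`|(g k t * g l t)%:E|)%E).
  apply: integrable_sum => // k _; apply: integrable_sum => // l _.
  exact: integrable_abse.
apply/funext => t; rewrite expr2 big_distrlr/= -sumEFin; apply: eq_bigr => k _.
by rewrite -sumEFin; apply: eq_bigr => l _; rewrite normrM.
Qed.

End orthonormal_theory.

Lemma avgs_gauss C phi (a : nat -> R) K : lip_test C phi ->
  avgs gam (fun k z => a k * z) K phi = gauss_avg (Num.sqrt (\sum_(k < K) a k ^+ 2)) phi.
Proof.
elim: K phi => [|K IH] phi phiC /=; first by rewrite big_ord0 sqrtr0 gauss_avg0.
rewrite -/(gauss_avg (a K) phi) IH; last exact: gauss_avg_lip.
rewrite (gauss_avg_add _ _ phiC) sqr_sqrtr ?big_ord_recr//.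
by apply: sumr_ge0 => k _; rewrite sqr_ge0.
Qed.

Definition normalized_sum {d d'} {Om : measurableType d} {T : measurableType d'}
    (xi : nat -> Om -> T) (g : T -> R) (n : nat) (w : Om) : R :=
  (Num.sqrt n%:R)^-1 * \sum_(i < n) g (xi i w).

Lemma clt_uniform {d d' d2} {Om : measurableType d} {T : measurableType d'}
    {Om' : measurableType d2}
    (P : probability Om R) (rho : probability T R) (xi : nat -> Om -> T)
    (Q : probability Om' R) (tau : nat -> Om' -> measurableTypeR R)
    (K : nat) (g : nat -> T -> R) C phi A e :
  iid_seq P rho xi -> iid_seq Q gam tau -> orthonormal rho K g ->
  smooth_test C phi -> 0 <= A -> 0 < e ->
  exists N, forall n, (N <= n)%N -> forall a : nat -> R,
    (forall k, (k < K)%N -> `|a k| <= A) ->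
    `|\int[P]_w phi (\sum_(k < K) a k * normalized_sum xi (g k) n w)
      - \int[Q]_w phi (\sum_(k < K) a k * tau k w)| <= e.
Proof.
move=> iidP iidQ og sphi A0 e0; have [phiC _] := sphi; have [C0 _ _] := phiC.
have mg (j : 'I_K) : measurable_fun setT (g j) by exact: (og.1 _ (ltn_ord j)).1.
(* One half for each of the two remainders of [clt_bound]; C + 1 because C may vanish. *)
pose e' := e / (C + 1) / 2.
have C1 : 0 < C + 1 by rewrite ltr_wpDl.
have e'0 : 0 < e' by rewrite !divr_gt0.
have msg : measurable_fun setT (fun t => \sum_(k < K) `|g k t|).
  by apply: measurable_sum => k; exact: measurableT_comp.
have [N1 HN1] := rem3_small (rho := rho) (g := fun t => \sum_(k < K) `|g k t|) msg
  (fun t => sumr_ge0 _ (fun k _ => normr_ge0 _)) (orthonormal_abs_sqr_int og) A0 e'0.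
pose A' := Num.sqrt (K%:R * A ^+ 2).
have [i2z _] : gam.-integrable setT (fun z : R => (`|z| ^+ 2)%:E) /\
    gam.-integrable setT (EFin \o (fun z : R => `|z|)).
  apply: integrable_of_sqr; first exact: normr_measurable.
  under eq_integral do rewrite real_normK ?num_real//.
  by rewrite gauss_moment2 ltry.
(* On the Gaussian side the envelope is sqrt(K A^2) |z|, because v <= K A^2. *)
have [N2 HN2] := rem3_small (rho := gam) (g := fun z => `|z|)
  (@normr_measurable R setT) (fun z => normr_ge0 z) i2z (sqrtr_ge0 (K%:R * A ^+ 2)) e'0.
exists (maxn 1 (maxn N1 N2)) => n; rewrite !geq_max => /and3P[n0 nN1 nN2] a aA.
pose G t := \sum_(k < K) a k * g k t.
have cG := orthonormal_comb og a.
have mG : measurable_fun setT G by case: cG.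
pose v := \sum_(k < K) a k ^+ 2.
have v0 : 0 <= v by apply: sumr_ge0 => k _; rewrite sqr_ge0.
have -> : \int[P]_w phi (\sum_(k < K) a k * normalized_sum xi (g k) n w) =
    \int[P]_w phi ((Num.sqrt n%:R)^-1 * \sum_(i < n) G (xi i w)).
  apply: eq_Rintegral => w _; congr phi; rewrite /G /normalized_sum exchange_big/= mulr_sumr.
  by apply: eq_bigr => k _; rewrite mulrCA; congr (_ * _); rewrite mulr_sumr.
have -> : \int[Q]_w phi (\sum_(k < K) a k * tau k w) = gauss_avg (Num.sqrt v) phi 0.
  rewrite -(avgs_gauss _ _ phiC) -(iid_avgs iidQ _ _ _ phiC)//.
    by apply: eq_Rintegral => w _; rewrite add0r.
  by move=> k; exact: measurable_funM.
apply: le_trans (clt_bound iidP sphi cG n0) _.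
have h1 := HN1 n nN1 n0 G mG.
have h2 := HN2 n nN2 n0 (fun z => Num.sqrt v * z).
rewrite (@le_trans _ _ (C * (e' + e')))//.
  apply: ler_wpM2l => //; apply: lerD.
    apply: h1 => t; rewrite /G mulr_sumr (le_trans (ler_norm_sum _ _ _))//.
    by apply: ler_sum => k _; rewrite normrM ler_wpM2r// aA.
  apply: h2 => [|z]; first exact: measurable_funM.
  rewrite normrM ler_wpM2r// ger0_norm ?sqrtr_ge0// ler_wsqrtr//.
  apply: (@le_trans _ _ (\sum_(k < K) A ^+ 2)).
    apply: ler_sum => k _; rewrite -[leLHS]real_normK ?num_real//.
    by rewrite lerXn2r// ?nnegrE// aA.
  by rewrite sumr_const card_ord mulr_natl.
rewrite /e' -splitr mulrA ler_pdivrMr// mulrC ler_wpM2l ?ltW//.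
by rewrite ltrDl.
Qed.

End clt.

(** * Bilinear forms in two independent families *)

Section bilinear.
Set Implicit Arguments.
Unset Strict Implicit.
Context {R : realType}.
Implicit Types (phi : R -> R) (C : R).
Notation gam := (normal_prob (0 : R) 1 : probability (measurableTypeR R) R).

(** The common pattern of the approximations below: a uniform error a plus an error q that is small
    only in mean. *)
Lemma Rintegral_close {d} {T : measurableType d} (P : probability T R)
    (f g q : T -> R) (a b : R) :
  P.-integrable setT (EFin \o f) -> P.-integrable setT (EFin \o g) ->
  measurable_fun setT q -> (forall t, 0 <= q t) -> (\int[P]_t (q t)%:E <= b%:E)%E ->
  (forall t, `|f t - g t| <= a + q t) ->
  `|\int[P]_t f t - \int[P]_t g t| <= a + b.
Proof.
move=> if_ ig mq q0 qb fg.
have iq : P.-integrable setT (EFin \o q).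
  apply/integrableP; split; first exact/measurable_EFinP.
  under eq_integral => t _ do rewrite gee0_abs ?lee_fin//.
  by rewrite (le_lt_trans qb)// ltry.
have iB : P.-integrable setT (EFin \o (fun t => f t - g t)).
  exact: (integrableB measurableT if_ ig).
have ia : P.-integrable setT (EFin \o cst a) by exact: finite_measure_integrable_cst.
have iaq : P.-integrable setT (EFin \o (fun t => a + q t)).
  exact: (integrableD measurableT ia iq).
rewrite -RintegralB//; apply: le_trans (le_normr_Rintegral _ _) _ => //.
apply: (@le_trans _ _ (\int[P]_t (a + q t))).
  by apply: le_Rintegral => //; exact: (integrable_norm iB).
rewrite RintegralD// Rintegral_cst_prob lerD2l -lee_fin.
by rewrite fineK//; exact: integrable_fin_num.
Qed.

Section double.
Context {d1 d2} {T1 : measurableType d1} {T2 : measurableType d2}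
  (P1 : probability T1 R) (P2 : probability T2 R) C phi (F : T1 * T2 -> R).
Hypotheses (phiC : lip_test C phi) (mF : measurable_fun [set: T1 * T2] F).

Let mphiF : measurable_fun [set: T1 * T2] (fun z => (phi (F z))%:E).
Proof. exact/measurable_EFinP/(test_comp_measurable phiC). Qed.

Let phiF0 (z : T1 * T2) : (0 <= (phi (F z))%:E)%E.
Proof. by rewrite lee_fin; case: phiC => _ /(_ (F z))/andP[]. Qed.

Let mF1 x : measurable_fun setT (fun y => F (x, y)).
Proof. exact: (measurableT_comp mF). Qed.

Lemma measurable_inner : measurable_fun setT (fun x => \int[P2]_y phi (F (x, y))).
Proof.
apply/measurable_EFinP.
rewrite (_ : EFin \o _ = fun x => (\int[P2]_y (phi (F (x, y)))%:E)%E); last first.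
  by apply/funext => x /=; rewrite (test_comp_EFin _ phiC (mF1 x)).
have := @measurable_fun_fubini_tonelli_F _ _ T1 T2 R P2 (fun z => (phi (F z))%:E) mphiF phiF0.
by rewrite /fubini_F.
Qed.

Lemma integrable_inner : P1.-integrable setT (EFin \o (fun x => \int[P2]_y phi (F (x, y)))).
Proof.
apply: (@bounded_integrable _ _ _ P1 _ 1); first exact: measurable_inner.
by move=> x; case/andP: (test_comp_01 P2 phiC (mF1 x)) => ? ?; rewrite ger0_norm.
Qed.

Lemma double_EFin : ((\int[P1]_x \int[P2]_y phi (F (x, y)))%:E =
  \int[P1]_x \int[P2]_y (phi (F (x, y)))%:E)%E.
Proof.
rewrite fineK; last by apply: integrable_fin_num => //; exact: integrable_inner.
by apply: eq_integral => x _; rewrite (test_comp_EFin _ phiC (mF1 x)).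
Qed.

End double.

Lemma double_swap {d1 d2} {T1 : measurableType d1} {T2 : measurableType d2}
    (P1 : probability T1 R) (P2 : probability T2 R) C phi (F : T1 * T2 -> R) :
  lip_test C phi -> measurable_fun [set: T1 * T2] F ->
  \int[P1]_x \int[P2]_y phi (F (x, y)) = \int[P2]_y \int[P1]_x phi (F (x, y)).
Proof.
move=> phiC mF; apply: EFin_inj; rewrite (double_EFin _ _ phiC mF).
have mF' : measurable_fun [set: T2 * T1] (fun z => F (z.2, z.1)).
  apply: (measurableT_comp mF).
  by apply/measurable_fun_pair; [exact: measurable_snd|exact: measurable_fst].
rewrite (double_EFin P2 P1 phiC mF').
apply: (@fubini_tonelli _ _ _ _ _ P1 P2 (fun z => (phi (F z))%:E)).
- exact/measurable_EFinP/(test_comp_measurable phiC).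
- by move=> z; rewrite lee_fin; case: phiC => _ /(_ (F z))/andP[].
Qed.

(** Orthonormality in L_2 stated through linear combinations, which is how [iid_moment2] delivers it
    for normalized sums and for Gaussian variables alike. *)
Definition isometric {d} {T : measurableType d} (P : probability T R) (K : nat)
    (U : nat -> T -> R) :=
  (forall k, (k < K)%N -> measurable_fun setT (U k)) /\
  forall a : nat -> R, (\int[P]_w ((\sum_(k < K) a k * U k w) ^+ 2)%:E =
                        (\sum_(k < K) a k ^+ 2)%:E)%E.

(** The only form in which independence of the two families is used: V may be replaced by an
    independent copy, realized by a second integration variable. *)
Definition decoupled {d} {T : measurableType d} (P : probability T R) (K : nat)
    (U V : nat -> T -> R) :=
  forall (c : nat -> nat -> R) (psi : R -> \bar R),
    measurable_fun setT psi -> (forall x, 0 <= psi x)%E ->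
    (\int[P]_w psi (\sum_(k < K) \sum_(l < K) c k l * U k w * V l w)%R =
     \int[P]_w \int[P]_w' psi (\sum_(k < K) \sum_(l < K) c k l * U k w * V l w')%R)%E.

Section bilinear_form.
Context {d1 d2} {T1 : measurableType d1} {T2 : measurableType d2} (K : nat)
  (c : nat -> nat -> R).

Lemma measurable_bilinear (U : nat -> T1 -> R) (V : nat -> T2 -> R) :
  (forall k, (k < K)%N -> measurable_fun setT (U k)) ->
  (forall l, (l < K)%N -> measurable_fun setT (V l)) ->
  measurable_fun [set: T1 * T2]
    (fun z => \sum_(k < K) \sum_(l < K) c k l * U k z.1 * V l z.2).
Proof.
move=> mU mV; apply: measurable_sum => k; apply: measurable_sum => l.
apply: measurable_funM; last first.
  by apply: measurableT_comp; [exact: mV|exact: measurable_snd].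
apply: measurable_funM => //.
by apply: measurableT_comp; [exact: mU|exact: measurable_fst].
Qed.

Lemma bilinearE1 (u v : nat -> R) :
  \sum_(k < K) \sum_(l < K) c k l * u k * v l =
  \sum_(k < K) (\sum_(l < K) c k l * v l) * u k.
Proof.
apply: eq_bigr => k _; rewrite mulr_suml; apply: eq_bigr => l _.
by rewrite mulrAC.
Qed.

Lemma bilinearE2 (u v : nat -> R) :
  \sum_(k < K) \sum_(l < K) c k l * u k * v l =
  \sum_(l < K) (\sum_(k < K) c k l * u k) * v l.
Proof.
by rewrite exchange_big; apply: eq_bigr => l _; rewrite mulr_suml.
Qed.

End bilinear_form.

Lemma isometric_coef {d} {T : measurableType d} (P : probability T R) K
    (W : nat -> T -> R) (c : nat -> nat -> R) : isometric P K W ->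
  (\int[P]_w (\sum_(k < K) (\sum_(l < K) c k l * W l w) ^+ 2)%:E =
   (\sum_(k < K) \sum_(l < K) c k l ^+ 2)%:E)%E.
Proof.
move=> [mW iW]; under eq_integral do rewrite -sumEFin.
rewrite ge0_integral_sum//.
- by rewrite -sumEFin; apply: eq_bigr => k _; rewrite iW.
- move=> k; apply/measurable_EFinP/measurable_funX/measurable_sum => l.
  by apply: measurable_funM => //; exact: mW.
- by move=> k w _; rewrite lee_fin sqr_ge0.
Qed.

(** The isometry is used twice: for V with U frozen, then for U. *)
Lemma bilinear_moment2 {d} {T : measurableType d} (P : probability T R) K
    (U V : nat -> T -> R) (c : nat -> nat -> R) :
  isometric P K U -> isometric P K V -> decoupled P K U V ->
  (\int[P]_w ((\sum_(k < K) \sum_(l < K) c k l * U k w * V l w) ^+ 2)%:E =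
   (\sum_(k < K) \sum_(l < K) c k l ^+ 2)%:E)%E.
Proof.
move=> iU iV dUV; rewrite (dUV c (fun x => (x ^+ 2)%:E)).
- transitivity (\int[P]_w (\sum_(l < K) (\sum_(k < K) c k l * U k w) ^+ 2)%:E)%E.
    apply: eq_integral => w _; rewrite -(iV.2 (fun l => \sum_(k < K) c k l * U k w)).
    by apply: eq_integral => w' _; rewrite (bilinearE2 K c (U^~ w) (V^~ w')).
  rewrite (isometric_coef (fun l k => c k l) iU).
  by rewrite exchange_big.
- exact/measurable_EFinP/measurable_funX.
- by move=> x; rewrite lee_fin sqr_ge0.
Qed.

Lemma decoupled_test {d} {T : measurableType d} (P : probability T R) K
    (U V : nat -> T -> R) (c : nat -> nat -> R) C phi :
  (forall k, (k < K)%N -> measurable_fun setT (U k)) ->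
  (forall l, (l < K)%N -> measurable_fun setT (V l)) ->
  decoupled P K U V -> lip_test C phi ->
  \int[P]_w phi (\sum_(k < K) \sum_(l < K) c k l * U k w * V l w) =
  \int[P]_w \int[P]_w' phi (\sum_(k < K) \sum_(l < K) c k l * U k w * V l w').
Proof.
move=> mU mV dUV phiC; have mB := measurable_bilinear c mU mV.
apply: EFin_inj; rewrite (double_EFin P P phiC mB)/=.
rewrite (test_comp_EFin _ phiC); last first.
  apply: measurable_sum => k; apply: measurable_sum => l.
  by apply: measurable_funM; [apply: measurable_funM => //; exact: mU|exact: mV].
apply: (dUV c (fun x => (phi x)%:E)).
- by apply/measurable_EFinP; exact: lip_test_measurable phiC.
- by move=> x; rewrite lee_fin; case: phiC => _ /(_ x)/andP[].
Qed.

(* If some coefficient at x exceeds A, then the difference of the two inner expectations,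
   which is at most 1, is bounded by the sum of the squared coefficients over A^2. *)
Lemma half_step {d0 d1 d2} {T0 : measurableType d0} {T1 : measurableType d1}
    {T2 : measurableType d2} (P0 : probability T0 R) (P1 : probability T1 R)
    (P2 : probability T2 R) K (W : nat -> T0 -> R) (U : nat -> T1 -> R)
    (U' : nat -> T2 -> R) (c : nat -> nat -> R) C phi A e :
  lip_test C phi -> isometric P0 K W ->
  (forall k, (k < K)%N -> measurable_fun setT (U k)) ->
  (forall k, (k < K)%N -> measurable_fun setT (U' k)) -> 0 < A -> 0 <= e ->
  (forall a : nat -> R, (forall k, (k < K)%N -> `|a k| <= A) ->
    `|\int[P1]_w phi (\sum_(k < K) a k * U k w) -
      \int[P2]_w phi (\sum_(k < K) a k * U' k w)| <= e) ->
  `|\int[P0]_x \int[P1]_w phi (\sum_(k < K) (\sum_(l < K) c k l * W l x) * U k w) -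
    \int[P0]_x \int[P2]_w phi (\sum_(k < K) (\sum_(l < K) c k l * W l x) * U' k w)|
  <= e + (\sum_(k < K) \sum_(l < K) c k l ^+ 2) / A ^+ 2.
Proof.
move=> phiC iW mU mU' A0 e0 H.
have mW := iW.1.
have mb k : measurable_fun setT (fun x => \sum_(l < K) c k l * W l x).
  by apply: measurable_sum => l; apply: measurable_funM => //; exact: mW.
pose S x := \sum_(k < K) (\sum_(l < K) c k l * W l x) ^+ 2.
have mS : measurable_fun setT S.
  by apply: measurable_sum => k; exact: measurable_funX.
have S0 x : 0 <= S x by apply: sumr_ge0 => k _; rewrite sqr_ge0.
have mBU d (T : measurableType d) (X : nat -> T -> R) :
    (forall k, (k < K)%N -> measurable_fun setT (X k)) ->
    measurable_fun [set: T0 * T]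
      (fun z => \sum_(k < K) (\sum_(l < K) c k l * W l z.1) * X k z.2).
  move=> mX; apply: measurable_sum => k; apply: measurable_funM.
    by apply: (measurableT_comp (mb k)); exact: measurable_fst.
  by apply: measurableT_comp; [exact: mX|exact: measurable_snd].
apply: (Rintegral_close (q := fun x => S x / A ^+ 2)).
- exact: (integrable_inner P0 P1 phiC (mBU _ _ _ mU)).
- exact: (integrable_inner P0 P2 phiC (mBU _ _ _ mU')).
- exact: measurable_funM.
- by move=> x; rewrite divr_ge0// sqr_ge0.
- under eq_integral do rewrite EFinM.
  rewrite ge0_integralZr//.
  + by rewrite (isometric_coef c iW) EFinM.
  + exact/measurable_EFinP.
  + by move=> x _; rewrite lee_fin.
  + by rewrite lee_fin invr_ge0 sqr_ge0.
- move=> x.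
  have [bA|/existsNP[k /not_implyP[kK /negP]]] :=
      pselect (forall k, (k < K)%N -> `|\sum_(l < K) c k l * W l x| <= A).
    apply: le_trans (H _ bA) _.
    by rewrite lerDl divr_ge0// sqr_ge0.
  rewrite -ltNge => Ak.
  have i1 := test_comp_01 P1 phiC (measurableT_comp (mBU _ _ _ mU) (measurable_pair1 x)).
  have i2 := test_comp_01 P2 phiC (measurableT_comp (mBU _ _ _ mU') (measurable_pair1 x)).
  apply: (@le_trans _ _ 1).
    move: i1 i2 => /= /andP[a0 a1] /andP[b0 b1].
    by rewrite ler_norml; apply/andP; split; lra.
  rewrite -[leLHS]add0r lerD// ler_pdivlMr ?exprn_gt0// mul1r.
  rewrite /S (bigD1 (Ordinal kK))//= -[leLHS]addr0 lerD//; last first.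
    by apply: sumr_ge0 => j _; rewrite sqr_ge0.
  by rewrite -[leRHS]real_normK ?num_real// lerXn2r// ?nnegrE ltW.
Qed.

Lemma bilinear_step {d d'} {T : measurableType d} {T' : measurableType d'}
    (P : probability T R) (Q : probability T' R) K (U V : nat -> T -> R)
    (tau theta : nat -> T' -> R) (c : nat -> nat -> R) C phi A e :
  lip_test C phi ->
  (forall k, (k < K)%N -> measurable_fun setT (U k)) -> isometric P K V ->
  isometric Q K tau -> (forall k, (k < K)%N -> measurable_fun setT (theta k)) ->
  decoupled P K U V -> decoupled Q K tau theta -> 0 < A -> 0 <= e ->
  (forall a : nat -> R, (forall k, (k < K)%N -> `|a k| <= A) ->
    `|\int[P]_w phi (\sum_(k < K) a k * U k w) -
      \int[Q]_w phi (\sum_(k < K) a k * tau k w)| <= e) ->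
  (forall a : nat -> R, (forall k, (k < K)%N -> `|a k| <= A) ->
    `|\int[P]_w phi (\sum_(k < K) a k * V k w) -
      \int[Q]_w phi (\sum_(k < K) a k * theta k w)| <= e) ->
  `|\int[P]_w phi (\sum_(k < K) \sum_(l < K) c k l * U k w * V l w) -
    \int[Q]_w phi (\sum_(k < K) \sum_(l < K) c k l * tau k w * theta l w)|
  <= (e + (\sum_(k < K) \sum_(l < K) c k l ^+ 2) / A ^+ 2) *+ 2.
Proof.
move=> phiC mU iV itau mtheta dUV dQ A0 e0 HU HV.
have mV := iV.1; have mtau := itau.1.
rewrite (decoupled_test c mU mV dUV phiC) (decoupled_test c mtau mtheta dQ phiC).
rewrite (double_swap P P phiC (measurable_bilinear c mU mV))/=.
have h1 := half_step c phiC iV mU mtau A0 e0 HU.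
have h2 := half_step (fun l k => c k l) phiC itau mV mtheta A0 e0 HV.
rewrite exchange_big/= in h2.
have sw := double_swap P Q phiC (measurable_bilinear (fun l k => c k l) mV mtau).
have E1 : \int[P]_y \int[P]_x phi (\sum_(k < K) \sum_(l < K) c k l * U k x * V l y) =
    \int[P]_x \int[P]_w phi (\sum_(k < K) (\sum_(l < K) c k l * V l x) * U k w).
  apply: eq_Rintegral => y _; apply: eq_Rintegral => x _.
  by rewrite (bilinearE1 K c (U^~ x) (V^~ y)).
have E2 : \int[P]_x \int[Q]_w phi (\sum_(k < K) (\sum_(l < K) c k l * V l x) * tau k w) =
    \int[Q]_x \int[P]_w phi (\sum_(k < K) (\sum_(l < K) c l k * tau l x) * V k w).
  transitivity (\int[P]_x \int[Q]_y phi (\sum_(k < K) \sum_(l < K) c l k * V k x * tau l y)).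
    apply: eq_Rintegral => x _; apply: eq_Rintegral => y _.
    by rewrite (bilinearE2 K (fun k l => c l k) (V^~ x) (tau^~ y)).
  rewrite sw; apply: eq_Rintegral => y _; apply: eq_Rintegral => x _.
  by rewrite (bilinearE1 K (fun k l => c l k) (V^~ x) (tau^~ y)).
have E3 : \int[Q]_w \int[Q]_w' phi (\sum_(k < K) \sum_(l < K) c k l * tau k w * theta l w') =
    \int[Q]_x \int[Q]_w phi (\sum_(k < K) (\sum_(l < K) c l k * tau l x) * theta k w).
  apply: eq_Rintegral => y _; apply: eq_Rintegral => x _.
  by rewrite (bilinearE2 K c (tau^~ y) (theta^~ x)).
rewrite E1 E3 mulr2n.
rewrite -(subrKA (\int[P]_x \int[Q]_w phi (\sum_(k < K) (\sum_(l < K) c k l * V l x) * tau k w))).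
apply: le_trans (ler_normD _ _) _; apply: lerD; first exact: h1.
by rewrite E2.
Qed.

Section realization.
Context {d dX dY} {Om : measurableType d} {X : measurableType dX}
  {Y : measurableType dY} (P : probability Om R) (mu : probability X R)
  (nu : probability Y R) (xi : nat -> Om -> X) (eta : nat -> Om -> Y).
Hypothesis ind : indep_family P mu nu xi eta.

Lemma indep_family_iid_l : iid_seq P mu xi.
Proof.
have [mxi meta H] := ind; split => // n A mA.
have := H (iota 0 n) [::] A (fun=> setT) (iota_uniq _ _) isT mA (fun=> measurableT).
rewrite big_nil mule1 (_ : \bigcap_(j in [set` [::]]) (eta j @^-1` setT) = setT) ?setIT//.
exact: bigcapT.
Qed.

Lemma indep_family_iid_r : iid_seq P nu eta.
Proof.
have [mxi meta H] := ind; split => // n B mB.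
have := H [::] (iota 0 n) (fun=> setT) B isT (iota_uniq _ _) (fun=> measurableT) mB.
by rewrite big_nil mul1e (_ : \bigcap_(j in [set` [::]]) _ = setT) ?setTI//; apply: bigcapT.
Qed.

Lemma indep_family_cyl n1 n2 (C1 C2 : set Om) : cyl xi n1 C1 -> cyl eta n2 C2 ->
  (P (C1 `&` C2) = P C1 * P C2)%E.
Proof.
move=> [A mA ->] [B mB ->]; have [_ _ H] := ind.
rewrite H ?iota_uniq//.
by rewrite (indep_family_iid_l).2// (indep_family_iid_r).2.
Qed.

(** The random variables fed to [indep_integral2] are identity maps into [Om] with the coarser
    sigma-algebras of the first coordinates; thus the whole families U and V are handled at once. *)
Lemma indep_family_decoupled K n1 n2 (U V : nat -> Om -> R) :
  (forall k, (k < K)%N -> measurable_fun setT (U k : g_sigma_algebraType (cyl xi n1) -> R)) ->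
  (forall l, (l < K)%N -> measurable_fun setT (V l : g_sigma_algebraType (cyl eta n2) -> R)) ->
  decoupled P K U V.
Proof.
move=> mU mV c psi mpsi psi0; have [mxi meta _] := ind.
have mB := measurable_bilinear c mU mV.
apply: (@indep_integral2 _ _ _ _ _ (g_sigma_algebraType (cyl xi n1))
  (g_sigma_algebraType (cyl eta n2)) P (cyl xi n1) (cyl eta n2) idfun idfun
  (fun z => psi (\sum_(k < K) \sum_(l < K) c k l * U k z.1 * V l z.2))).
- exact: cyl_measurable.
- exact: cylI.
- exact: cylT.
- exact: cyl_measurable.
- exact: cylI.
- exact: cylT.
- by move=> A B; exact: indep_family_cyl.
- exact: measurable_id.
- exact: measurable_id.
- exact: measurableT_comp.
- by move=> z; exact: psi0.
Qed.

End realization.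

Section normalized.
Context {d dX} {Om : measurableType d} {X : measurableType dX}
  (P : probability Om R) (mu : probability X R) (xi : nat -> Om -> X).

Lemma cyl_normalized_sum n (g : X -> R) : measurable_fun setT g ->
  measurable_fun setT (normalized_sum xi g n : g_sigma_algebraType (cyl xi n) -> R).
Proof.
move=> mg; apply: measurable_funM => //.
by apply: measurable_sum => i; apply: measurableT_comp => //; exact: cyl_coord.
Qed.

Lemma isometric_normalized_sum K (g : nat -> X -> R) n : iid_seq P mu xi ->
  orthonormal mu K g -> (0 < n)%N ->
  isometric P K (fun k => normalized_sum xi (g k) n).
Proof.
move=> iid og n0.
have mg k : (k < K)%N -> measurable_fun setT (g k) by move=> kK; exact: (og.1 _ kK).1.
split=> [k kK|a].
  apply: (measurable_fun_g_sigma (G := cyl xi n)); first exact: cyl_measurable iid.1.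
  exact: cyl_normalized_sum (mg k kK).
set r := (Num.sqrt n%:R)^-1 : R.
have n0R : 0 < n%:R :> R by rewrite ltr0n.
have r2 : r ^+ 2 = n%:R^-1 by rewrite /r exprVn sqr_sqrtr// ltW.
have cG := centered_scale r (orthonormal_comb og a).
have := iid_moment2 n 0 iid (fun=> cG).
rewrite expr0n add0r sumr_const card_ord -mulr_natl r2 mulrA divff ?gt_eqF// mul1r => <-.
apply: eq_integral => w _; congr ((_ ^+ 2)%:E).
rewrite add0r -mulr_sumr exchange_big/= mulr_sumr; apply: eq_bigr => k _.
by rewrite /normalized_sum -/r mulrCA; congr (_ * _); rewrite mulr_sumr.
Qed.

End normalized.

Lemma isometric_gauss {d} {Om : measurableType d} (Q : probability Om R)
    (tau : nat -> Om -> measurableTypeR R) K : iid_seq Q gam tau ->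
  isometric Q K (tau : nat -> Om -> R).
Proof.
move=> iid; split=> [k _|a]; first exact: iid.1.
have cG k := centered_scale (a k) (@gauss_centered R).
have := iid_moment2 K 0 iid cG.
rewrite expr0n add0r; under [in RHS]eq_bigr do rewrite mulr1.
by move=> <-; apply: eq_integral => w _; rewrite add0r.
Qed.

Lemma bilinear_clt {d dX dY d'} {Om : measurableType d} {X : measurableType dX}
    {Y : measurableType dY} {Om' : measurableType d'}
    (P : probability Om R) (mu : probability X R) (nu : probability Y R)
    (Q : probability Om' R) (xi : nat -> Om -> X) (eta : nat -> Om -> Y)
    (tau theta : nat -> Om' -> measurableTypeR R) K (g : nat -> X -> R) (h : nat -> Y -> R)
    (c : nat -> nat -> R) C phi e :
  indep_family P mu nu xi eta -> indep_family Q gam gam tau theta ->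
  orthonormal mu K g -> orthonormal nu K h -> smooth_test C phi -> 0 < e ->
  exists N, forall n1 n2, (N <= n1)%N -> (N <= n2)%N ->
  `|\int[P]_w phi (\sum_(k < K) \sum_(l < K)
       c k l * normalized_sum xi (g k) n1 w * normalized_sum eta (h l) n2 w) -
    \int[Q]_w phi (\sum_(k < K) \sum_(l < K) c k l * tau k w * theta l w)| <= e.
Proof.
move=> indP indQ og oh sphi e0; have [phiC _] := sphi.
have iP1 := indep_family_iid_l indP; have iP2 := indep_family_iid_r indP.
have iQ1 := indep_family_iid_l indQ; have iQ2 := indep_family_iid_r indQ.
have mg k : (k < K)%N -> measurable_fun setT (g k) by move=> kK; exact: (og.1 _ kK).1.
have mh k : (k < K)%N -> measurable_fun setT (h k) by move=> kK; exact: (oh.1 _ kK).1.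
pose S := \sum_(k < K) \sum_(l < K) c k l ^+ 2.
have S0 : 0 <= S by apply: sumr_ge0 => k _; apply: sumr_ge0 => l _; rewrite sqr_ge0.
have e4 : 0 < e / 4 by rewrite divr_gt0.
(* Makes the Chebyshev term S / A^2 at most e / 4. Each of the two half steps then costs e / 4 + e /
   4; S + 1 keeps A positive. *)
pose A := Num.sqrt ((S + 1) / (e / 4)).
have S1 : 0 < S + 1 by rewrite ltr_wpDl.
have A0 : 0 < A by rewrite sqrtr_gt0 divr_gt0.
have SA : S / A ^+ 2 <= e / 4.
  rewrite ler_pdivrMr ?exprn_gt0// sqr_sqrtr ?divr_ge0 ?ltW// mulrC divfK ?gt_eqF//.
  by rewrite ltrDl.
have [N1 H1] := clt_uniform iP1 iQ1 og sphi (ltW A0) e4.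
have [N2 H2] := clt_uniform iP2 iQ2 oh sphi (ltW A0) e4.
exists (maxn 1 (maxn N1 N2)) => n1 n2.
rewrite !geq_max => /and3P[n10 n1N _] /and3P[n20 _ n2N].
have cP : decoupled P K (fun k => normalized_sum xi (g k) n1)
    (fun l => normalized_sum eta (h l) n2).
  apply: (indep_family_decoupled indP (n1 := n1) (n2 := n2)) => k kK.
    exact: cyl_normalized_sum (mg k kK).
  exact: cyl_normalized_sum (mh k kK).
have cQ : decoupled Q K (tau : nat -> Om' -> R) theta.
  by apply: (indep_family_decoupled indQ (n1 := K) (n2 := K)) => k kK; exact: cyl_coord.
have iU := isometric_normalized_sum iP1 og n10.
have iV := isometric_normalized_sum iP2 oh n20.
have := bilinear_step c phiC iU.1 iV (isometric_gauss K iQ1) (isometric_gauss K iQ2).1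
  cP cQ A0 (ltW e4) (H1 n1 n1N) (H2 n2 n2N).
move/le_trans; apply; rewrite -/S.
apply: (@le_trans _ _ ((e / 4 + e / 4) *+ 2)); first by rewrite lerMn2r/= lerD2l.
by rewrite -mulr_natr; lra.
Qed.

End bilinear.

(** * Reduction of weak convergence to smooth test functions *)

Section step.
Set Implicit Arguments.
Unset Strict Implicit.
Context {R : realType}.
Implicit Types (phi : R -> R) (C : R).

Let pos (x : R) : R := Num.max x 0.

Let posP x : (x <= 0 /\ pos x = 0) \/ (0 <= x /\ pos x = x).
Proof.
by rewrite /pos; case: (lerP x 0) => x0; [left|right; split => //; exact: ltW].
Qed.

(** If x and x + h lie on the same side of 0, the remainder is 0 or h^3. If the sign changes, it is
    (x + h)^3 or h^3 - (x + h)^3, and |x + h| <= |h| there. *)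
Let cube_taylor (x h : R) :
  `|pos (x + h) ^+ 3 - pos x ^+ 3 - 3 * pos x ^+ 2 * h - 3 * pos x * h ^+ 2| <= `|h| ^+ 3.
Proof.
have hh : `|h| ^+ 3 = `|h ^+ 3| by rewrite normrX.
case: (posP x) => -[x0 ->]; case: (posP (x + h)) => -[xh0 ->].
- by rewrite !(expr0n, mulr0, mul0r, subrr, normr0) exprn_ge0.
- have h0 : 0 <= h by lra.
  have -> : (x + h) ^+ 3 - 0 ^+ 3 - 3 * 0 ^+ 2 * h - 3 * 0 * h ^+ 2 = (x + h) ^+ 3 by ring.
  rewrite (ger0_norm h0) ger0_norm ?exprn_ge0//.
  by rewrite lerXn2r// ?nnegrE//; lra.
- have h0 : h <= 0 by lra.
  rewrite (ler0_norm h0) expr0n/=.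
  have -> : 0 - x ^+ 3 - 3 * x ^+ 2 * h - 3 * x * h ^+ 2 = h ^+ 3 - (x + h) ^+ 3 by ring.
  have k1 : 0 <= (- (x + h)) ^+ 3 by rewrite exprn_ge0//; lra.
  have k2 : (- (x + h)) ^+ 3 <= (- h) ^+ 3 by rewrite lerXn2r// ?nnegrE; lra.
  have e1 : (- (x + h)) ^+ 3 = - (x + h) ^+ 3 by ring.
  have e2 : (- h) ^+ 3 = - h ^+ 3 by ring.
  by rewrite ler_norml; apply/andP; split; lra.
- by rewrite hh; have -> : (x + h) ^+ 3 - x ^+ 3 - 3 * x ^+ 2 * h - 3 * x * h ^+ 2 = h ^+ 3 by ring.
Qed.

(* The cumulative integral of the quadratic B-spline with knots 0, 1, 2, 3. *)
Definition step (x : R) : R :=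
  (pos x ^+ 3 - 3 * pos (x - 1) ^+ 3 + 3 * pos (x - 2) ^+ 3 - pos (x - 3) ^+ 3) / 6.

(** The Taylor coefficients of [step]: [step1] is its derivative and [step2] half of its second
    derivative. *)
Let step1 (x : R) : R :=
  (pos x ^+ 2 - 3 * pos (x - 1) ^+ 2 + 3 * pos (x - 2) ^+ 2 - pos (x - 3) ^+ 2) / 2.

Let step2 (x : R) : R :=
  (pos x - 3 * pos (x - 1) + 3 * pos (x - 2) - pos (x - 3)) / 2.

Lemma step_le0 x : x <= 0 -> step x = 0.
Proof.
move=> x0; rewrite /step.
have p y : y <= 0 -> pos y = 0 by move=> y0; apply/max_idPr.
by rewrite !p; [rewrite !expr0n/=; ring|lra..].
Qed.

Lemma step_ge3 x : 3 <= x -> step x = 1.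
Proof.
move=> x0; rewrite /step.
have p y : 0 <= y -> pos y = y by move=> y0; apply/max_idPl.
by rewrite !p; [field|lra..].
Qed.

Let region (x : R) : x <= 0 \/ [\/ 0 <= x <= 1, 1 <= x <= 2, 2 <= x <= 3 | 3 <= x].
Proof.
have [?|?] := lerP x 0; [by left|right].
have [?|?] := lerP x 1; first by constructor 1; apply/andP; split => //; exact: ltW.
have [?|?] := lerP x 2; first by constructor 2; apply/andP; split => //; exact: ltW.
have [?|?] := lerP x 3; first by constructor 3; apply/andP; split => //; exact: ltW.
by constructor 4; exact: ltW.
Qed.

Let pos_le y : y <= 0 -> pos y = 0. Proof. by move=> y0; apply/max_idPr. Qed.
Let pos_ge y : 0 <= y -> pos y = y. Proof. by move=> y0; apply/max_idPl. Qed.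

Lemma step_01 x : 0 <= step x <= 1.
Proof.
case: (region x) => [x0|[/andP[a b]|/andP[a b]|/andP[a b]|x3]].
- by rewrite step_le0// lexx ler01.
- rewrite /step (pos_ge a) !(@pos_le (x - _)); try lra.
  have h := exprn_ge0 3 a; have h1 : x ^+ 3 <= 1 by rewrite exprn_ile1.
  by rewrite !expr0n/=; apply/andP; split; lra.
- rewrite /step (@pos_ge x) ?(@pos_ge (x - 1)) ?(@pos_le (x - 2)) ?(@pos_le (x - 3)); try lra.
  have [t [t0 t1 ->]] : exists t, [/\ 0 <= t, t <= 1 & x = t + 1].
    by exists (x - 1); split; lra.
  have h := exprn_ge0 3 t0; have h2 : 0 <= t ^+ 2 * (1 - t) by rewrite mulr_ge0 ?sqr_ge0//; lra.
  have h3 : 0 <= (1 - t) * (1 - t) * (1 + t * 2) by rewrite !mulr_ge0//; lra.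
  rewrite !expr0n/= addrK; apply/andP; split.
    have -> : ((t + 1) ^+ 3 - 3 * t ^+ 3 + 3 * 0 - 0) / 6 = (1 + 3 * t + t ^+ 2 * (1 - t) * 2 + t ^+ 2) / 6 by field.
    by have := sqr_ge0 t; lra.
  rewrite -subr_ge0.
  have -> : 1 - ((t + 1) ^+ 3 - 3 * t ^+ 3 + 3 * 0 - 0) / 6 =
    (4 - 3 * t + (1 - t) * (1 - t) * (1 + t * 2)) / 6 by field.
  by lra.
- rewrite /step (@pos_ge x) ?(@pos_ge (x - 1)) ?(@pos_ge (x - 2)) ?(@pos_le (x - 3)); try lra.
  have [t [t0 t1 ->]] : exists t, [/\ 0 <= t, t <= 1 & x = 3 - t].
    by exists (3 - x); split; lra.
  have h := exprn_ge0 3 t0; have h1 : t ^+ 3 <= 1 by rewrite exprn_ile1.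
  have -> : ((3 - t) ^+ 3 - 3 * (3 - t - 1) ^+ 3 + 3 * (3 - t - 2) ^+ 3 - 0 ^+ 3) / 6 =
     1 - t ^+ 3 / 6 by rewrite !expr0n/=; field.
  by apply/andP; split; lra.
- by rewrite step_ge3// lexx ler01.
Qed.

Let step1_le x : `|step1 x| <= 1.
Proof.
rewrite /step1; case: (region x) => [x0|[/andP[a b]|/andP[a b]|/andP[a b]|x3]].
- rewrite (pos_le x0) !(@pos_le (x - _)); try lra.
  by rewrite !expr0n/= !(mulr0, subr0, addr0, mul0r) normr0 ler01.
- rewrite (pos_ge a) !(@pos_le (x - _)); try lra.
  by rewrite !expr0n/= ler_norml; apply/andP; split; nra.
- rewrite (@pos_ge x) ?(@pos_ge (x - 1)) ?(@pos_le (x - 2)) ?(@pos_le (x - 3)); try lra.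
  by rewrite !expr0n/= ler_norml; apply/andP; split; nra.
- rewrite (@pos_ge x) ?(@pos_ge (x - 1)) ?(@pos_ge (x - 2)) ?(@pos_le (x - 3)); try lra.
  by rewrite !expr0n/= ler_norml; apply/andP; split; nra.
- rewrite !pos_ge; try lra.
  have -> : (x ^+ 2 - 3 * (x - 1) ^+ 2 + 3 * (x - 2) ^+ 2 - (x - 3) ^+ 2) / 2 = 0 by field.
  by rewrite normr0 ler01.
Qed.

Let step2_le x : `|step2 x| <= 1.
Proof.
rewrite /step2; case: (region x) => [x0|[/andP[a b]|/andP[a b]|/andP[a b]|x3]].
- rewrite (pos_le x0) !(@pos_le (x - _)); try lra.
  by rewrite ler_norml; apply/andP; split; lra.
- rewrite (pos_ge a) !(@pos_le (x - _)); try lra.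
  by rewrite ler_norml; apply/andP; split; lra.
- rewrite (@pos_ge x) ?(@pos_ge (x - 1)) ?(@pos_le (x - 2)) ?(@pos_le (x - 3)); try lra.
  by rewrite ler_norml; apply/andP; split; lra.
- rewrite (@pos_ge x) ?(@pos_ge (x - 1)) ?(@pos_ge (x - 2)) ?(@pos_le (x - 3)); try lra.
  by rewrite ler_norml; apply/andP; split; lra.
- by rewrite !pos_ge; try lra; rewrite ler_norml; apply/andP; split; lra.
Qed.

(** The weights 1, 3, 3, 1 of the four truncated cubes sum to 8, and 8/6 <= 2. *)
Let step_cubic x h :
  `|step (x + h) - step x - step1 x * h - step2 x * h ^+ 2| <= 2 * `|h| ^+ 3.
Proof.
pose r y := pos (y + h) ^+ 3 - pos y ^+ 3 - 3 * pos y ^+ 2 * h - 3 * pos y * h ^+ 2.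
have -> : step (x + h) - step x - step1 x * h - step2 x * h ^+ 2 =
   (r x - 3 * r (x - 1) + 3 * r (x - 2) - r (x - 3)) / 6.
  rewrite /r /step /step1 /step2 (addrAC x h) (addrAC x h (-2)) (addrAC x h (-3)).
  by field.
have R0 := cube_taylor x h; have R1 := cube_taylor (x - 1) h.
have R2 := cube_taylor (x - 2) h; have R3 := cube_taylor (x - 3) h.
rewrite -/(r x) in R0; rewrite -/(r (x - 1)) in R1.
rewrite -/(r (x - 2)) in R2; rewrite -/(r (x - 3)) in R3.
have h0 : 0 <= `|h| ^+ 3 by rewrite exprn_ge0.
move: R0 R1 R2 R3; rewrite !ler_norml => /andP[? ?] /andP[? ?] /andP[? ?] /andP[? ?].
by apply/andP; split; lra.
Qed.

(** For |h| <= 1 the cubic bound gives the Lipschitz constant 1 + 1 + 2 = 4. For |h| > 1 increments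
    of [step] are at most 1, which settles the Lipschitz bound and leaves a Taylor remainder of at
    most 1 + |h| + h^2 <= 3 h^2. *)
Lemma step_smooth : smooth_test 4 step.
Proof.
have S01 x h : `|step (x + h) - step x| <= 1.
  have /andP[? ?] := step_01 x; have /andP[? ?] := step_01 (x + h).
  by rewrite ler_norml; apply/andP; split; lra.
have small x h : `|h| <= 1 -> `|step (x + h) - step x| <= 4 * `|h|.
  move=> h1; have := step_cubic x h; have := step1_le x; have := step2_le x.
  have n0 := normr_ge0 h.
  have h3 : `|h| ^+ 3 <= `|h| by rewrite -[leRHS]expr1 ler_wiXn2l.
  have h2 : `|h ^+ 2| <= `|h| by rewrite normrX -[leRHS]expr1 ler_wiXn2l.
  have a1 : `|step1 x * h| <= `|h| by rewrite normrM ler_piMl// step1_le.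
  have a2 : `|step2 x * h ^+ 2| <= `|h|.
    by rewrite normrM (le_trans _ h2)// ler_piMl// step2_le.
  move=> _ _; move: a1 a2; rewrite !ler_norml => /andP[? ?] /andP[? ?] /andP[? ?].
  by apply/andP; split; lra.
split.
  split => [//||x y]; first exact: step_01.
  have e : y + (x - y) = x by rewrite addrC subrK.
  have := S01 y (x - y); have := @small y (x - y); rewrite e => sm b1.
  have [/sm//|xy] := lerP `|x - y| 1.
  by rewrite (le_trans b1)//; lra.
move=> x; exists (step1 x), (step2 x) => h; rewrite /rem3.
have n0 := normr_ge0 h.
have hE : h ^+ 2 = `|h| ^+ 2 by rewrite real_normK ?num_real.
have [h1|h1] := lerP `|h| 1.
  have -> : Num.min (h ^+ 2) (`|h| ^+ 3) = `|h| ^+ 3.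
    by apply/min_idPr; rewrite hE ler_wiXn2l.
  apply: le_trans (step_cubic x h) _; rewrite ler_wpM2r ?exprn_ge0//; lra.
have -> : Num.min (h ^+ 2) (`|h| ^+ 3) = h ^+ 2.
  by apply/min_idPl; rewrite hE ler_eXn2l// ltW.
have b0 := S01 x h.
have a1 : `|step1 x * h| <= `|h| by rewrite normrM ler_piMl// step1_le.
have a2 : `|step2 x * h ^+ 2| <= h ^+ 2.
  by rewrite normrM [X in _ * X]ger0_norm ?sqr_ge0// ler_piMl ?sqr_ge0// step2_le.
have h2 : `|h| <= h ^+ 2 by rewrite hE -[leLHS]expr1 ler_eXn2l// ltW.
move: b0 a1 a2; rewrite !ler_norml => /andP[? ?] /andP[? ?] /andP[? ?].
by apply/andP; split; lra.
Qed.

(** The Lipschitz constant picks up |a|; the other two powers come from [rem3 (a * h)] being at most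
    a^2 + |a|^3 times [rem3 h]. *)
Lemma smooth_test_affine C phi (a b : R) : smooth_test C phi ->
  smooth_test (C * (`|a| + a ^+ 2 + `|a| ^+ 3)) (fun x => phi (a * x + b)).
Proof.
move=> [[C0 p01 lip] tay].
have a2 := sqr_ge0 a; have a1 := normr_ge0 a; have a3 := exprn_ge0 3 a1.
have C0' : C * `|a| <= C * (`|a| + a ^+ 2 + `|a| ^+ 3) by apply: ler_wpM2l => //; lra.
split; first split.
- by apply: mulr_ge0 => //; lra.
- by move=> x; exact: p01.
- move=> x y; apply: le_trans (lip _ _) _.
  rewrite opprD addrACA subrr addr0 -mulrBr normrM mulrA.
  by apply: ler_wpM2r.
move=> x; have [d1 [d2 t]] := tay (a * x + b).
exists (d1 * a), (d2 * a ^+ 2) => h.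
have := t (a * h).
have -> : a * x + b + a * h = a * (x + h) + b by ring.
rewrite [d1 * (a * h)]mulrA exprMn [d2 * (_ * _)]mulrA => /le_trans; apply.
rewrite -mulrA ler_wpM2l//.
have r0 := rem3_ge0 h.
rewrite /rem3 in r0 *.
have : Num.min ((a * h) ^+ 2) (`|a * h| ^+ 3) <=
    (a ^+ 2 + `|a| ^+ 3) * Num.min (h ^+ 2) (`|h| ^+ 3).
  rewrite normrM !exprMn ge_min.
  have [hm|hm] := leP (h ^+ 2) (`|h| ^+ 3).
    by rewrite ler_wpM2r ?sqr_ge0//; lra.
  by rewrite [X in _ || X]ler_wpM2r ?orbT ?exprn_ge0//; lra.
by move/le_trans; apply; apply: ler_wpM2r => //; lra.
Qed.

(** Only x is confined to the interval. Each point gets half of its continuity radius, so that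
    nearby x' and every y within d of x' stay in the ball around it. *)
Lemma unif_continuous_itv phi (a b e : R) : continuous phi -> 0 < e ->
  exists2 del, 0 < del & forall x y, a <= x <= b -> `|x - y| <= del ->
    `|phi x - phi y| <= e.
Proof.
move=> cphi e0.
have /compact_near_coveringP cov : compact `[a, b] by exact: segment_compact.
have e20 : 0 < e / 2 by rewrite divr_gt0.
have H := cov R (0 : R)^'+ (fun d x => forall y, `|x - y| <= d -> `|phi x - phi y| <= e) _.
have : \forall d \near (0 : R)^'+, `[a, b] `<=`
    (fun x => forall y, `|x - y| <= d -> `|phi x - phi y| <= e).
  apply: H => x _.
  have /cvgrPdist_le/(_ _ e20) := cphi x.
  rewrite -nbhs_ballE => -[r /= r0 rP].
  have r20 : 0 < r / 2 by rewrite divr_gt0.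
  exists (ball x (r / 2), [set d | d < r / 2]).
    by split => /=; [exact: nbhsx_ballx|exact: nbhs_right_lt].
  move=> [x' d] [/= xx' dr] y xy.
  rewrite -(subrKA (phi x)) (splitr e); apply: le_trans (ler_normD _ _) _; apply: lerD.
    rewrite distrC; apply: rP; rewrite /ball/=; rewrite /ball/= in xx'.
    by rewrite (lt_trans xx')// ltr_pdivrMr// mulr_natr mulr2n ltrDl.
  apply: rP; rewrite /ball/= -(subrKA x') (splitr r).
  by rewrite (le_lt_trans (ler_normD _ _))// ltrD// (le_lt_trans xy).
move=> K; near (0 : R)^'+ => d.
exists d => // x y xab xy.
by apply: (near K d) => //=; rewrite in_itv.
Unshelve. all: by end_near. Qed.

Section step_sum.
Variables (phi : R -> R) (c del e : R).
Hypotheses (del0 : 0 < del) (e0 : 0 <= e).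
Let node n := c + n%:R * del.

(** A smoothed staircase: each term carries the value from one node to the next, but gradually over
    three meshes, as [step] rises on [0, 3]. The argument is written a x + b to fit
    [smooth_test_affine]. *)
Fixpoint step_sum n (x : R) : R :=
  if n is n'.+1 then
    step_sum n' x + (phi (node n'.+1) - phi (node n')) * step (del^-1 * x + - (del^-1 * node n'))
  else phi c.

Let nodeS n : node n.+1 = node n + del.
Proof. by rewrite /node -natr1 mulrDl mul1r addrA. Qed.

Let argE n x : del^-1 * x + - (del^-1 * node n) = (x - node n) / del.
Proof. by rewrite -mulrBr mulrC. Qed.

Lemma step_sum_left n x : x <= c -> step_sum n x = phi c.
Proof.
move=> xc; elim: n => //= n ->; rewrite step_le0 ?mulr0 ?addr0// argE.
rewrite pmulr_lle0 ?invr_gt0// subr_le0 (le_trans xc)// /node lerDl mulr_ge0//.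
exact: ltW.
Qed.

Section osc.
Variable n : nat.
Hypothesis osc : forall x y, c <= x <= node n -> `|x - y| <= del -> `|phi x - phi y| <= e.

Let inc i : (i < n)%N -> `|phi (node i.+1) - phi (node i)| <= e.
Proof.
move=> ni; apply: osc; last by rewrite nodeS addrC addKr ger0_norm// ltW.
have d0 := ltW del0.
by rewrite /node lerDl mulr_ge0//= lerD2l ler_wpM2r// ler_nat.
Qed.

(* Only the last two steps before the node can be incomplete to its right; each further
   mesh width to the left adds one more incomplete step. *)
Let step_sum_right i m x : (i <= n)%N -> node i + (2 - m%:R) * del <= x ->
  `|step_sum i x - phi (node i)| <= m%:R * e.
Proof.
elim: i m => [|i IH] m ni xi.
  by rewrite /= /node mul0r addr0 subrr normr0 mulr_ge0.
have /andP[s0 s1] := step_01 (del^-1 * x + - (del^-1 * node i)).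
case: m xi => [|m] xi.
  rewrite mul0r normr_le0 subr_eq0 /= step_ge3.
    have := IH 0%N (ltnW ni); rewrite mul0r normr_le0 subr_eq0 => h.
    rewrite (eqP (h _)); first by rewrite mulr1 addrC subrK.
    by move: xi; rewrite nodeS; have := del0; lra.
  by rewrite argE ler_pdivlMr//; move: xi; rewrite nodeS; have := del0; lra.
have h : `|step_sum i x - phi (node i)| <= m%:R * e.
  apply: IH; first exact: ltnW.
  by move: xi; rewrite nodeS -natr1; lra.
have -> : m.+1%:R * e = m%:R * e + e by rewrite -natr1 mulrDl mul1r.
rewrite /=; set s := step _ in s0 s1 *.
have -> : step_sum i x + (phi (node i.+1) - phi (node i)) * s - phi (node i.+1) =
  (step_sum i x - phi (node i)) + (phi (node i.+1) - phi (node i)) * (s - 1) by ring.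
apply: le_trans (ler_normD _ _) _; apply: lerD => //.
rewrite normrM -[leRHS]mulr1 ler_pM ?inc//.
by rewrite ler_norml; apply/andP; split; lra.
Qed.

Let step_sum_mid i x : (i <= n)%N -> c <= x -> x <= node i ->
  `|step_sum i x - phi x| <= 4 * e.
Proof.
elim: i => [|i IH] ni cx xi.
  have -> : x = c by apply/eqP; rewrite eq_le cx andbT; rewrite /node mul0r addr0 in xi.
  by rewrite subrr normr0 mulr_ge0.
have [xle|xgt] := lerP x (node i).
  rewrite /= step_le0 ?mulr0 ?addr0; first by apply: IH => //; exact: ltnW.
  by rewrite argE pmulr_lle0 ?invr_gt0// subr_le0.
rewrite -(subrKA (phi (node i.+1))).
(* [step_sum_right] is used with m = 3, since x is at most one mesh to the left of [node i.+1]; the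
   last e is the oscillation of phi over that mesh. *)
have -> : 4 * e = 3%:R * e + e by ring.
apply: le_trans (ler_normD _ _) _; apply: lerD.
  apply: step_sum_right => //; rewrite nodeS; have := del0; lra.
apply: osc.
  by rewrite (le_trans cx xi)/= /node lerD2l ler_wpM2r ?ler_nat// ltW.
rewrite ger0_norm ?subr_ge0//; move: xgt; rewrite nodeS; lra.
Qed.

Lemma step_sum_close x : c <= x <= node n -> `|step_sum n x - phi x| <= 4 * e.
Proof. by move=> /andP[cx xn]; exact: step_sum_mid. Qed.

Lemma step_sum_bound B : (forall x, `|phi x| <= B) ->
  forall x, `|step_sum n x| <= B + 4 * e.
Proof.
move=> phiB x.
have B4 : B <= B + 4 * e by rewrite lerDl mulr_ge0.
have [xc|cx] := lerP x c; first by rewrite step_sum_left// (le_trans (phiB _)).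
have near y : `|step_sum n x - phi y| <= 4 * e -> `|step_sum n x| <= B + 4 * e.
  move=> h; rewrite -(subrK (phi y) (step_sum n x)) addrC.
  by rewrite (le_trans (ler_normD _ _))// lerD.
have [xn|nx] := lerP x (node n); first by apply/(near x)/step_sum_close; rewrite ltW.
(* Right of the last node at most two steps are incomplete: m = 2. *)
apply: (near (node n)); apply: (@le_trans _ _ (2%:R * e)); last by rewrite ler_wpM2r// ler_nat.
by apply: step_sum_right => //; rewrite subrr mul0r addr0 ltW.
Qed.

End osc.
End step_sum.

Section portmanteau.
Context {d d'} {Om : measurableType d} {Om' : measurableType d'}
  (P : probability Om R) (Q : probability Om' R) (X : nat -> nat -> Om -> R)
  (Y : Om' -> R) (B : R) (N0 : nat).
Hypotheses (mX : forall n1 n2, measurable_fun setT (X n1 n2))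
  (mY : measurable_fun setT Y)
  (X2 : forall n1 n2, (N0 <= n1)%N -> (N0 <= n2)%N -> (\int[P]_w (X n1 n2 w ^+ 2)%:E <= B%:E)%E)
  (Y2 : (\int[Q]_w (Y w ^+ 2)%:E <= B%:E)%E).

(** Measurability and boundedness are bundled with convergence so that the class is closed under
    linear combinations. One N for both indices expresses min(n1, n2) -> oo. *)
Definition cvg_test phi := [/\ measurable_fun setT phi,
  exists D, forall x, `|phi x| <= D &
  forall e, 0 < e -> exists N, forall n1 n2, (N <= n1)%N -> (N <= n2)%N ->
    `|\int[P]_w phi (X n1 n2 w) - \int[Q]_w phi (Y w)| <= e].

Hypothesis cvg_smooth : forall C phi, smooth_test C phi -> cvg_test phi.

Let bounded_comp_integrable dT (T : measurableType dT) (m : probability T R) phi (Z : T -> R) :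
  measurable_fun setT phi -> (exists D, forall x, `|phi x| <= D) ->
  measurable_fun setT Z -> m.-integrable setT (EFin \o (fun w => phi (Z w))).
Proof.
move=> mphi [D phiD] mZ; apply: (@bounded_integrable _ _ _ m _ D); last by move=> x.
exact: measurableT_comp.
Qed.

Lemma cvg_test_addZ phi psi b : cvg_test phi -> cvg_test psi ->
  cvg_test (fun x => phi x + b * psi x).
Proof.
move=> [mphi bphi cphi] [mpsi bpsi cpsi]; split.
- by apply: measurable_funD => //; exact: measurable_funM.
- have [D1 h1] := bphi; have [D2 h2] := bpsi; exists (D1 + `|b| * D2) => x.
  by rewrite (le_trans (ler_normD _ _))// lerD// normrM ler_wpM2l.
- move=> e e0; have e20 : 0 < e / 2 by rewrite divr_gt0.
  have b1 : 0 < `|b| + 1 by rewrite ltr_wpDl.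
  have [N1 H1] := cphi _ e20; have [N2 H2] := cpsi _ (divr_gt0 e20 b1).
  exists (maxn N1 N2) => n1 n2; rewrite !geq_max => /andP[a1 a2] /andP[a3 a4].
  have intE dT (T : measurableType dT) (m : probability T R) (Z : T -> R) :
      measurable_fun setT Z -> \int[m]_w (phi (Z w) + b * psi (Z w)) =
      \int[m]_w phi (Z w) + b * \int[m]_w psi (Z w).
    move=> mZ; have i1 := bounded_comp_integrable m mphi bphi mZ.
    have i2 := bounded_comp_integrable m mpsi bpsi mZ.
    rewrite RintegralD ?RintegralZl//.
    by have := integrableZl measurableT b i2.
  rewrite !intE// opprD addrACA -mulrBr (splitr e).
  apply: le_trans (ler_normD _ _) _; apply: lerD; first exact: H1.
  rewrite normrM (le_trans (ler_wpM2l (normr_ge0 b) (H2 _ _ a2 a4)))//.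
  by rewrite mulrA ler_pdivrMr// mulrC ler_wpM2l// ?lerDl// ltW.
Qed.

Lemma cvg_test_cst b : cvg_test (fun=> b).
Proof.
split => //; first by exists `|b|.
by move=> e e0; exists 0%N => n1 n2 _ _; rewrite !Rintegral_cst_prob subrr normr0 ltW.
Qed.

Lemma cvg_test_step_sum phi c del n : 0 < del -> cvg_test (step_sum phi c del n).
Proof.
move=> del0; elim: n => [|n IH] /=; first exact: cvg_test_cst.
apply: (cvg_test_addZ (psi := fun x => step (del^-1 * x + - (del^-1 * (c + n%:R * del))))) => //.
exact/cvg_smooth/smooth_test_affine/step_smooth.
Qed.

Lemma cvg_test_continuous phi : continuous phi -> (exists D, forall x, `|phi x| <= D) ->
  cvg_test phi.
Proof.
move=> cphi [D phiD]; have mphi : measurable_fun setT phi by exact: continuous_measurable_fun.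
have D0 : 0 <= D by rewrite (le_trans _ (phiD 0)).
have B0 : 0 <= B.
  rewrite -lee_fin (le_trans _ Y2)//; apply: integral_ge0 => w _.
  by rewrite lee_fin sqr_ge0.
split => //; first by exists D.
move=> e e0.
(* With e1 <= 1/4 the staircase is bounded by D + 1. The total error will be 5 e1 + e1 + 5 e1, below
   16 e1 <= e. *)
pose e1 := Num.min (e / 16) (1 / 4).
have e10 : 0 < e1 by rewrite lt_min !divr_gt0.
have e1e : 16 * e1 <= e by rewrite mulrC -ler_pdivlMr// ge_min lexx.
have e14 : 4 * e1 <= 1 by rewrite mulrC -ler_pdivlMr// ge_min lexx orbT.
have D1 : 0 <= 2 * D + 1 by have := D0; lra.
pose DB := (2 * D + 1) * B + 1.
have DB0 : 0 < DB by rewrite ltr_wpDl// mulr_ge0.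
pose A := Num.sqrt (DB / e1).
have A0 : 0 < A by rewrite sqrtr_gt0 divr_gt0.
have A2 : (2 * D + 1) / A ^+ 2 * B <= e1.
  have -> : A ^+ 2 = DB / e1 by rewrite sqr_sqrtr// divr_ge0// ltW.
  have -> : (2 * D + 1) / (DB / e1) * B = (2 * D + 1) * B / DB * e1.
    by field; rewrite !gt_eqF.
  by rewrite ler_piMl ?(ltW e10)// ler_pdivrMr// mul1r lerDl.
have [del del0 osc] := unif_continuous_itv (- A) A cphi e10.
(* n + 1 equal meshes fill [-A, A] exactly, each of width at most [del]. *)
pose n := Num.truncn (2 * A / del).
pose del' := 2 * A / n.+1%:R.
have del'0 : 0 < del' by rewrite divr_gt0// mulr_gt0.
have nodeE : - A + n.+1%:R * del' = A.
  by rewrite /del' mulrC divfK ?pnatr_eq0//; ring.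
have del'le : del' <= del.
  by rewrite /del' ler_pdivrMr// -ler_pdivrMl// mulrC ltW// truncnS_gt.
have osc' x y : - A <= x <= - A + n.+1%:R * del' -> `|x - y| <= del' -> `|phi x - phi y| <= e1.
  by rewrite nodeE => xA xy; apply: osc => //; exact: le_trans del'le.
pose psi := step_sum phi (- A) del' n.+1.
have [mpsi bpsi cpsi] := cvg_test_step_sum phi (- A) n.+1 del'0.
have psi_b := step_sum_bound del'0 (ltW e10) osc' phiD.
have psi_c := step_sum_close del'0 (ltW e10) osc'; rewrite nodeE in psi_c.
(* Outside [-A, A] the factor x^2 / A^2 exceeds 1 and the trivial bound D + (D + 1) is enough; in
   mean this term is at most e1 by the choice of A. *)
have pw x : `|phi x - psi x| <= 4 * e1 + (2 * D + 1) / A ^+ 2 * x ^+ 2.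
  have r0 : 0 <= (2 * D + 1) / A ^+ 2 * x ^+ 2.
    by rewrite mulr_ge0 ?sqr_ge0// divr_ge0 ?sqr_ge0.
  have [xA|xA] := boolP (- A <= x <= A).
    by rewrite distrC (le_trans (psi_c _ xA))// lerDl.
  apply: (@le_trans _ _ (2 * D + 1)).
    rewrite (le_trans (ler_normB _ _))//.
    by have := phiD x; have := psi_b x; rewrite -/psi; lra.
  rewrite -[leLHS]add0r lerD ?mulr_ge0 ?(ltW e10)// mulrAC ler_pdivlMr ?exprn_gt0//.
  rewrite ler_wpM2l//.
  rewrite -[leRHS]real_normK ?num_real//.
  have xA' : A < `|x| by rewrite ltNge ler_norml.
  by rewrite lerXn2r// ?nnegrE ltW.
have close dT (T : measurableType dT) (m : probability T R) (V : T -> R) :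
    measurable_fun setT V -> (\int[m]_w (V w ^+ 2)%:E <= B%:E)%E ->
    `|\int[m]_w phi (V w) - \int[m]_w psi (V w)| <= 4 * e1 + e1.
  move=> mV V2.
  apply: (Rintegral_close (q := fun w => (2 * D + 1) / A ^+ 2 * V w ^+ 2)).
  - by apply: bounded_comp_integrable => //; exists D.
  - exact: bounded_comp_integrable.
  - by apply: measurable_funM => //; exact: measurable_funX.
  - by move=> w; rewrite mulr_ge0 ?sqr_ge0// divr_ge0 ?sqr_ge0.
  - under eq_integral do rewrite EFinM.
    have k0 : (0 <= ((2 * D + 1) / A ^+ 2)%:E)%E.
      by rewrite lee_fin divr_ge0 ?sqr_ge0.
    rewrite ge0_integralZl//.
    + by rewrite (le_trans (lee_wpmul2l k0 V2))// -EFinM lee_fin.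
    + exact/measurable_EFinP/measurable_funX.
    + by move=> w _; rewrite lee_fin sqr_ge0.
  - by move=> w; exact: pw.
have [N HN] := cpsi _ e10.
exists (maxn N0 N) => n1 n2; rewrite !geq_max => /andP[a1 a2] /andP[a3 a4].
have h1 := close _ _ P _ (mX n1 n2) (X2 a1 a3); have h2 := close _ _ Q _ mY Y2.
have h3 := HN _ _ a2 a4; rewrite -/psi in h3.
move: h1 h2 h3; rewrite !ler_norml => /andP[? ?] /andP[? ?] /andP[? ?].
by apply/andP; split; lra.
Qed.

End portmanteau.
End step.

(** * L_2 approximation on rectangles *)

Section second_moments.
Set Implicit Arguments.
Unset Strict Implicit.
Context {R : realType}.
Implicit Types (phi : R -> R) (C : R).

Definition moment2 {d} {T : measurableType d} (P : probability T R) (f : T -> R) : \bar R :=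
  (\int[P]_w (f w ^+ 2)%:E)%E.

Lemma moment2D {d} {T : measurableType d} (P : probability T R) (f g : T -> R) a b :
  measurable_fun setT f -> measurable_fun setT g ->
  (moment2 P f <= a%:E -> moment2 P g <= b%:E ->
   moment2 P (fun w => (f w + g w)%R) <= (2 * (a + b))%:E)%E.
Proof.
move=> mf mg fa gb.
have m2 (h : T -> R) : measurable_fun setT h -> measurable_fun setT (fun w => (h w ^+ 2)%:E).
  by move=> mh; apply/measurable_EFinP/measurable_funX.
apply: (@le_trans _ _ (\int[P]_w (2%:E * ((f w ^+ 2)%:E + (g w ^+ 2)%:E)))%E).
  apply: ge0_le_integral => //.
  - by move=> w _; rewrite lee_fin sqr_ge0.
  - by apply: m2; exact: measurable_funD.
  - by apply: emeasurable_funM => //; apply: emeasurable_funD; exact: m2.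
  - move=> w _; rewrite -EFinD -EFinM lee_fin.
    by have := sqr_ge0 (f w - g w); nra.
rewrite ge0_integralZl//; last 2 first.
- by apply: emeasurable_funD; exact: m2.
- by move=> w _; rewrite -EFinD lee_fin addr_ge0// sqr_ge0.
rewrite ge0_integralD//; [|by move=> w _; rewrite lee_fin sqr_ge0|exact: m2|
  by move=> w _; rewrite lee_fin sqr_ge0|exact: m2].
rewrite [leRHS]EFinM; apply: lee_wpmul2l => //; rewrite EFinD; exact: leeD.
Qed.

Lemma pnorm2_small {d} {T : measurableType d} (P : probability T R) (f : T -> R) (e : R) :
  0 <= e -> (pnorm P 2 f <= e%:E)%E -> (moment2 P f <= (e ^+ 2)%:E)%E.
Proof.
move=> e0 fe.
have -> : moment2 P f = poweR (pnorm P 2 f) 2.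
  rewrite /pnorm poweR_Lnorm ?pnatr_eq0//; apply: eq_integral => w _ /=.
  by rewrite powR_mulrn// real_normK ?num_real.
have -> : (e ^+ 2)%:E = poweR e%:E 2 by rewrite poweR_EFin powR_mulrn.
by apply: gt0_ler_poweR => //; rewrite in_itv/= ?leey andbT ?lee_fin// Lnorm_ge0.
Qed.

Lemma pnorm2_cvg0 {d} {T : measurableType d} (P : probability T R) (f : nat -> T -> R) e :
  0 < e -> (fun m => pnorm P 2 (f m)) @ \oo --> 0%E ->
  exists N, forall m, (N <= m)%N -> (moment2 P (f m) <= e%:E)%E.
Proof.
move=> e0 /fine_cvgP[[N1 _ fin]] /cvgrPdist_le/(_ (Num.sqrt e)).
rewrite sqrtr_gt0 => /(_ e0)[N2 _ small].
exists (maxn N1 N2) => m; rewrite geq_max => /andP[m1 m2].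
have <- : Num.sqrt e ^+ 2 = e by rewrite sqr_sqrtr// ltW.
apply: pnorm2_small; first exact: sqrtr_ge0.
rewrite -(fineK (fin m m1)) lee_fin.
by have := small m m2; rewrite /= sub0r normrN => /(le_trans (ler_norm _)).
Qed.

(** Integrate |x| <= e + x^2 / e. With [del] equal to e^2 the bound becomes 2 C e. *)
Lemma lip_test_close {d} {T : measurableType d} (P : probability T R) C phi
    (f g : T -> R) e del : lip_test C phi ->
  measurable_fun setT f -> measurable_fun setT g -> 0 < e ->
  (moment2 P (fun w => f w - g w)%R <= del%:E)%E ->
  `|\int[P]_w phi (f w) - \int[P]_w phi (g w)| <= C * e + C / e * del.
Proof.
move=> phiC mf mg e0 fg; have [C0 _ lip] := phiC.
apply: (Rintegral_close (q := fun w => C / e * (f w - g w) ^+ 2)).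
- exact: (test_comp_integrable P phiC mf).
- exact: (test_comp_integrable P phiC mg).
- by apply: measurable_funM => //; apply: measurable_funX; exact: measurable_funB.
- by move=> w; rewrite mulr_ge0 ?sqr_ge0// divr_ge0// ltW.
- have k0 : (0 <= (C / e)%:E)%E by rewrite lee_fin divr_ge0// ltW.
  under eq_integral do rewrite EFinM.
  rewrite ge0_integralZl//.
  + by rewrite (le_trans (lee_wpmul2l k0 fg))// -EFinM.
  + by apply/measurable_EFinP; apply: measurable_funX; exact: measurable_funB.
  + by move=> w _; rewrite lee_fin sqr_ge0.
- move=> w; rewrite (le_trans (lip _ _))// -mulrA -mulrDr ler_wpM2l//.
  set x := f w - g w.
  have xe : `|x| = `|x| * e / e by rewrite mulfK// gt_eqF.
  rewrite xe -ler_pdivlMr ?invr_gt0// invrK mulrDl mulrAC mulVf ?gt_eqF// mul1r.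
  have -> : x ^+ 2 = `|x| ^+ 2 by rewrite real_normK ?num_real.
  by have := sqr_ge0 (`|x| - e); have := normr_ge0 x; nra.
Qed.

Lemma sqr_sum_le (I : Type) (s : seq I) (x : I -> R) :
  (\sum_(i <- s) x i) ^+ 2 <= (size s)%:R * \sum_(i <- s) x i ^+ 2.
Proof.
elim: s => [|i s IH]; first by rewrite !big_nil expr0n mulr0.
rewrite !big_cons /= -natr1.
case: s IH => [|j s] IH; first by rewrite !big_nil !addr0 add0r mul1r.
set S := \sum_(_ <- _) x _ in IH *; set T := \sum_(_ <- _) _ in IH *.
have n0 : 1 <= (size (j :: s))%:R :> R by rewrite ler1n.
set n := (size (j :: s))%:R in IH n0 *.
(* Young's inequality with weight n: 2 x S <= n x^2 + S^2 / n, and S^2 <= n T by induction. Division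
   by n is why the empty tail was treated apart. *)
have k : 2 * (x i * S) <= n * x i ^+ 2 + T.
  have h : 2 * (n * (x i * S)) <= n ^+ 2 * x i ^+ 2 + n * T.
    by have := sqr_ge0 (n * x i - S); nra.
  have nn : 0 < n by rewrite (lt_le_trans ltr01).
  rewrite -(ler_pM2l nn); nra.
nra.
Qed.

End second_moments.

Section rectangle.
Set Implicit Arguments.
Unset Strict Implicit.
Context {R : realType} {d dX dY} {Om : measurableType d} {X : measurableType dX}
  {Y : measurableType dY} (P : probability Om R) (mu : probability X R)
  (nu : probability Y R) (xi : nat -> Om -> X) (eta : nat -> Om -> Y).
Hypothesis ind : indep_family P mu nu xi eta.

(** All pairs (xi i, eta j) have the law of (xi 0, eta 0), so what is known of f at the first pair
    holds at every point of L. *)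
Lemma indep_family_pair i j (F : X * Y -> \bar R) :
  measurable_fun [set: X * Y] F -> (forall z, 0 <= F z)%E ->
  (\int[P]_w F (xi i w, eta j w) = \int[mu]_x \int[nu]_y F (x, y))%E.
Proof.
move=> mF F0; have [mxi meta H] := ind.
have i1 := indep_family_iid_l ind; have i2 := indep_family_iid_r ind.
rewrite (@indep_integral _ _ _ _ _ _ _ P nu (xi i) (eta j))//.
  pose xi' : {mfun Om >-> X} := HB.pack (xi i) (isMeasurableFun.Build _ _ _ _ (xi i) (mxi i)).
  rewrite -(@ge0_integral_distribution _ _ _ _ _ P xi' (fun x => \int[nu]_y F (x, y))%E).
  - by apply: eq_measure_integral => A mA _; exact: (iid_law i1).
  - exact: measurable_fun_fubini_tonelli_F.
  - by move=> x; exact: integral_ge0.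
move=> A B mA mB; rewrite (iid_law i1)//.
have := H [:: i] [:: j] (fun=> A) (fun=> B) isT isT (fun=> mA) (fun=> mB).
by rewrite !big_seq1 !bigcap_seq !big_seq1.
Qed.

Lemma rect_sum n1 n2 (F : nat * nat -> R) :
  \sum_(ij <- rect n1 n2) F ij = \sum_(i < n1) \sum_(j < n2) F (i : nat, j : nat).
Proof.
rewrite /rect big_allpairs_dep/= -{1}(subn0 n1) big_mkord.
by apply: eq_bigr => i _; rewrite -{1}(subn0 n2) big_mkord.
Qed.

Lemma size_rect n1 n2 : size (rect n1 n2) = (n1 * n2)%N.
Proof. by rewrite /rect size_allpairs !size_iota. Qed.

(** The shape of L matters here: over a rectangle the sum of a product g(x) h(y) factorizes, and so
    does the normalizer sqrt(n1 n2). *)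
Lemma S_L_bilinear K (c : nat -> nat -> R) (g : nat -> X -> R) (h : nat -> Y -> R) n1 n2 w :
  S_L xi eta (fun x y => \sum_(k < K) \sum_(l < K) c k l * g k x * h l y) (rect n1 n2) w =
  \sum_(k < K) \sum_(l < K) c k l * normalized_sum xi (g k) n1 w * normalized_sum eta (h l) n2 w.
Proof.
rewrite /S_L rect_sum size_rect natrM sqrtrM// invfM /normalized_sum.
under eq_bigr => i _ do rewrite exchange_big/=.
rewrite exchange_big/= mulr_sumr; apply: eq_bigr => k _.
under eq_bigr => i _ do rewrite exchange_big/=.
rewrite exchange_big/= mulr_sumr; apply: eq_bigr => l _.
set r1 := (Num.sqrt n1%:R)^-1; set r2 := (Num.sqrt n2%:R)^-1.
have -> : \sum_(i < n1) \sum_(j < n2) c k l * g k (xi i w) * h l (eta j w) =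
    c k l * ((\sum_(i < n1) g k (xi i w)) * (\sum_(j < n2) h l (eta j w))).
  rewrite big_distrlr/= mulr_sumr; apply: eq_bigr => i _.
  by rewrite mulr_sumr; apply: eq_bigr => j _; rewrite mulrA.
by ring.
Qed.

Lemma S_LB (f1 f2 : X -> Y -> R) L w :
  S_L xi eta f1 L w - S_L xi eta f2 L w = S_L xi eta (fun x y => f1 x y - f2 x y) L w.
Proof. by rewrite /S_L -mulrBr sumrB. Qed.

Lemma measurable_S_L (f : X -> Y -> R) L : measurable_fun [set: X * Y] (fun z => f z.1 z.2) ->
  measurable_fun setT (S_L xi eta f L).
Proof.
move=> mf; have [mxi meta _] := ind; apply: measurable_funM => //.
apply: measurable_sum => ij.
exact: (measurableT_comp (f := fun z => f z.1 z.2) mf (measurable_fun_pair (mxi _) (meta _))).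
Qed.

(** Cauchy-Schwarz without any cancellation between summands. The lost factor |L| is harmless where
    L is fixed before e is chosen. *)
Lemma moment2_S_L_crude (f : X -> Y -> R) L e :
  measurable_fun [set: X * Y] (fun z => f z.1 z.2) ->
  (moment2 P (fun w => f (xi 0%N w) (eta 0%N w)) <= e%:E)%E ->
  (moment2 P (S_L xi eta f L) <= ((size L)%:R * e)%:E)%E.
Proof.
move=> mf fe; have [mxi meta _] := ind.
have mfij (ij : nat * nat) : measurable_fun setT (fun w => f (xi ij.1 w) (eta ij.2 w)).
  exact: (measurableT_comp (f := fun z => f z.1 z.2) mf (measurable_fun_pair (mxi _) (meta _))).
have m2 (h : Om -> R) : measurable_fun setT h -> measurable_fun setT (fun w => (h w ^+ 2)%:E).
  by move=> mh; apply/measurable_EFinP/measurable_funX.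
apply: (@le_trans _ _ (\int[P]_w \sum_(ij <- L) (f (xi ij.1 w) (eta ij.2 w) ^+ 2)%:E)%E).
  apply: ge0_le_integral => //.
  - by move=> w _; rewrite lee_fin sqr_ge0.
  - by apply: m2; exact: measurable_S_L.
  - by apply: emeasurable_sum => ij; exact: m2.
  - move=> w _; rewrite sumEFin lee_fin /S_L exprMn exprVn sqr_sqrtr//.
    have [L0|L0] := posnP (size L).
      by rewrite L0 invr0 mul0r; apply: sumr_ge0 => ij _; rewrite sqr_ge0.
    by rewrite mulrC ler_pdivrMr ?ltr0n// mulrC; exact: sqr_sum_le.
rewrite ge0_integral_sum//; [|by move=> ij; exact: m2|by move=> ij w _; rewrite lee_fin sqr_ge0].
apply: (@le_trans _ _ (\sum_(ij <- L) e%:E)%E); last first.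
  by rewrite sumEFin big_const_seq count_predT iter_addr_0 mulr_natl.
apply: lee_sum => ij _; apply: le_trans fe; rewrite /moment2.
have mF : measurable_fun [set: X * Y] (fun z => (f z.1 z.2 ^+ 2)%:E).
  by apply/measurable_EFinP/measurable_funX.
rewrite (@indep_family_pair ij.1 ij.2 (fun z => (f z.1 z.2 ^+ 2)%:E))//; last first.
  by move=> z; rewrite lee_fin sqr_ge0.
rewrite (@indep_family_pair 0 0 (fun z => (f z.1 z.2 ^+ 2)%:E))//.
by move=> z; rewrite lee_fin sqr_ge0.
Qed.

Lemma moment2_S_L_bilinear K (c : nat -> nat -> R) (g : nat -> X -> R) (h : nat -> Y -> R) n1 n2 :
  orthonormal mu K g -> orthonormal nu K h -> (0 < n1)%N -> (0 < n2)%N ->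
  (moment2 P (S_L xi eta (fun x y => \sum_(k < K) \sum_(l < K) c k l * g k x * h l y)%R (rect n1 n2))
   = (\sum_(k < K) \sum_(l < K) c k l ^+ 2)%:E)%E.
Proof.
move=> og oh n10 n20.
have i1 := indep_family_iid_l ind; have i2 := indep_family_iid_r ind.
have dc : decoupled P K (fun k => normalized_sum xi (g k) n1)
    (fun l => normalized_sum eta (h l) n2).
  apply: (indep_family_decoupled ind (n1 := n1) (n2 := n2)) => k kK.
    exact: cyl_normalized_sum (og.1 k kK).1.
  exact: cyl_normalized_sum (oh.1 k kK).1.
rewrite -(bilinear_moment2 c (isometric_normalized_sum i1 og n10)
  (isometric_normalized_sum i2 oh n20) dc).
by apply: eq_integral => w _; rewrite S_L_bilinear.
Qed.

End rectangle.

(** * Truncation of the index range and of the kernel *)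

Section truncation.
Set Implicit Arguments.
Unset Strict Implicit.

(** Turns the sums filtered by [inM M] into plain initial sums, for finite and infinite M at
    once. *)
Definition trunc_size (M : option nat) (m : nat) : nat :=
  if M is Some m0 then minn m m0 else m.

Lemma trunc_size_inM M m k : (k < trunc_size M m)%N -> inM M k.
Proof. by case: M => //= m0; rewrite leq_min => /andP[]. Qed.

Lemma trunc_size_le M m m' : (m <= m')%N -> (trunc_size M m <= trunc_size M m')%N.
Proof. by case: M => //= m0 mm'; rewrite leq_min !geq_min mm' leqnn !orbT. Qed.

Lemma sum_inM (V : nmodType) M m (F : nat -> V) :
  \sum_(k < m | inM M k) F k = \sum_(k < trunc_size M m) F k.
Proof.
case: M => [m0|] //=; have [mm0|m0m] := leqP m m0.
  by apply: eq_bigl => k; rewrite (leq_trans (ltn_ord k)).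
by rewrite (big_ord_widen_cond m predT F) ?(ltnW m0m).
Qed.

Lemma sum_inM2 (V : nmodType) M m (F : nat -> nat -> V) :
  \sum_(k < m | inM M k) \sum_(l < m | inM M l) F k l =
  \sum_(k < trunc_size M m) \sum_(l < trunc_size M m) F k l.
Proof.
rewrite (sum_inM M m (fun k => \sum_(l < m | inM M l) F k l)).
by apply: eq_bigr => k _; rewrite sum_inM.
Qed.

(** As a 0-1 factor on the coefficients it makes the difference of two truncated kernels a bilinear
    kernel again, so the isometry applies to it. *)
Definition off_block (K k l : nat) : bool := ~~ ((k < K)%N && (l < K)%N).

Lemma sum_off_block (R : pzRingType) K K' (F : nat -> nat -> R) : (K <= K')%N ->
  \sum_(k < K') \sum_(l < K') F k l - \sum_(k < K) \sum_(l < K) F k l =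
  \sum_(k < K') \sum_(l < K') (off_block K k l)%:R * F k l.
Proof.
move=> KK'; rewrite (big_ord_widen K' (fun k => \sum_(l < K) F k l))//.
rewrite [X in _ - X]big_mkcond/= -sumrB; apply: eq_bigr => k _.
rewrite /off_block; case: (ltnP k K) => kK /=; last first.
  by rewrite subr0; apply: eq_bigr => l _; rewrite mul1r.
rewrite (@big_ord_widen _ _ _ K K' (F k))// [X in _ - X]big_mkcond/= -sumrB.
by apply: eq_bigr => l _; case: (ltnP l K) => lK /=; rewrite ?subrr ?mul0r// subr0 mul1r.
Qed.

End truncation.

Section truncated_kernel.
Set Implicit Arguments.
Unset Strict Implicit.
Context {R : realType} {d dX dY} {Om : measurableType d} {X : measurableType dX}
  {Y : measurableType dY} (P : probability Om R) (mu : probability X R)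
  (nu : probability Y R) (xi : nat -> Om -> X) (eta : nat -> Om -> Y).
Hypothesis ind : indep_family P mu nu xi eta.
Variables (K : nat -> nat) (lam : nat -> nat -> R) (g : nat -> X -> R)
  (h : nat -> Y -> R) (f : X -> Y -> R) (s : R).
Hypotheses (K_le : forall m m', (m <= m')%N -> (K m <= K m')%N)
  (og : forall m, orthonormal mu (K m) g) (oh : forall m, orthonormal nu (K m) h)
  (mf : measurable_fun [set: X * Y] (fun z => f z.1 z.2)).

Definition trunc_kernel m x y := \sum_(k < K m) \sum_(l < K m) lam k l * g k x * h l y.

Hypotheses (lam_s : (fun m => \sum_(k < K m) \sum_(l < K m) lam k l ^+ 2) @ \oo --> s)
  (f_lim : forall e, 0 < e -> exists N, forall m, (N <= m)%N ->
    (moment2 P (fun w => f (xi 0%N w) (eta 0%N w) -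
       trunc_kernel m (xi 0%N w) (eta 0%N w))%R <= e%:E)%E).

Lemma measurable_trunc_kernel m :
  measurable_fun [set: X * Y] (fun z => trunc_kernel m z.1 z.2).
Proof.
apply: measurable_bilinear => k kK; first exact: ((og m).1 k kK).1.
exact: ((oh m).1 k kK).1.
Qed.

Lemma moment2_S_L_trunc e : 0 < e -> exists N, forall m, (N <= m)%N ->
  forall n1 n2, (0 < n1)%N -> (0 < n2)%N ->
  (moment2 P (fun w => S_L xi eta f (rect n1 n2) w -
     S_L xi eta (trunc_kernel m) (rect n1 n2) w)%R <= e%:E)%E.
Proof.
(* [moment2D] doubles, hence e = 2 (r + r). Partial sums within r / 2 of s differ by at most r. *)
move=> e0; pose r := e / 4; have r0 : 0 < r by rewrite divr_gt0.
have r20 : 0 < r / 2 by rewrite divr_gt0.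
have /cvgrPdist_le/(_ _ r20)[N _ HN] := lam_s.
exists N => m Nm n1 n2 n10 n20.
have N0 : 0 < (n1 * n2)%:R :> R by rewrite ltr0n muln_gt0 n10.
(* N1 depends on the rectangle, which is allowed: only N has to be uniform, and m' does not occur in
   the result. *)
have [N1 HN1] := f_lim (divr_gt0 r0 N0).
pose m' := maxn m N1.
have mm' : (m <= m')%N by rewrite leq_maxl.
have mT := measurable_trunc_kernel.
have mS j : measurable_fun setT (S_L xi eta (trunc_kernel j) (rect n1 n2)).
  exact: (measurable_S_L ind).
have mSf : measurable_fun setT (S_L xi eta f (rect n1 n2)) by exact: (measurable_S_L ind).
rewrite (_ : (fun w => _) = (fun w => (S_L xi eta f (rect n1 n2) w -
     S_L xi eta (trunc_kernel m') (rect n1 n2) w) +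
     (S_L xi eta (trunc_kernel m') (rect n1 n2) w -
     S_L xi eta (trunc_kernel m) (rect n1 n2) w))); last first.
  by apply/funext => w; rewrite subrKA.
have -> : e = 2 * (r + r) by rewrite /r; field.
apply: moment2D.
- exact: measurable_funB.
- exact: measurable_funB.
- rewrite (_ : (fun w => _) = S_L xi eta (fun x y => f x y - trunc_kernel m' x y) (rect n1 n2)); last first.
    by apply/funext => w; rewrite S_LB.
  have -> : r = (size (rect n1 n2))%:R * (r / (n1 * n2)%:R).
    by rewrite size_rect mulrC divfK// gt_eqF.
  apply: (moment2_S_L_crude ind); first exact: measurable_funB.
  by apply: HN1; rewrite leq_maxr.
- pose c k l := (off_block (K m) k l)%:R * lam k l.
  rewrite (_ : (fun w => _) = S_L xi eta
    (fun x y => \sum_(k < K m') \sum_(l < K m') c k l * g k x * h l y) (rect n1 n2)); last first.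
    apply/funext => w; rewrite S_LB; congr (S_L _ _ _ _ w); apply/funext => x; apply/funext => y.
    rewrite /trunc_kernel (sum_off_block (fun k l => lam k l * g k x * h l y) (K_le mm')).
    by apply: eq_bigr => k _; apply: eq_bigr => l _; rewrite /c !mulrA.
  rewrite (moment2_S_L_bilinear ind c (og m') (oh m') n10 n20) lee_fin.
  have -> : \sum_(k < K m') \sum_(l < K m') c k l ^+ 2 =
      \sum_(k < K m') \sum_(l < K m') lam k l ^+ 2 - \sum_(k < K m) \sum_(l < K m) lam k l ^+ 2.
    rewrite (sum_off_block (fun k l => lam k l ^+ 2) (K_le mm')).
    apply: eq_bigr => k _; apply: eq_bigr => l _; rewrite /c exprMn.
    by case: off_block; rewrite ?expr1n ?expr0n.
  have := HN m Nm; have := HN m' (leq_trans Nm mm').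
  by rewrite /= !ler_norml => /andP[? ?] /andP[? ?]; rewrite (splitr r); lra.
Qed.

End truncated_kernel.

(** * Passage to the limit *)

Section limit.
Set Implicit Arguments.
Unset Strict Implicit.
Context {R : realType} {d dX dY d'} {Om : measurableType d} {X : measurableType dX}
  {Y : measurableType dY} {Om' : measurableType d'} (P : probability Om R)
  (mu : probability X R) (nu : probability Y R) (Q : probability Om' R)
  (xi : nat -> Om -> X) (eta : nat -> Om -> Y)
  (tau theta : nat -> Om' -> measurableTypeR R) (Sinf : Om' -> R).
Notation gam := (normal_prob (0 : R) 1 : probability (measurableTypeR R) R).
Hypotheses (ind : indep_family P mu nu xi eta)
  (indQ : indep_family Q gam gam tau theta) (mSinf : measurable_fun setT Sinf).
Variables (K : nat -> nat) (lam : nat -> nat -> R) (g : nat -> X -> R)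
  (h : nat -> Y -> R) (f : X -> Y -> R) (s : R).
Hypotheses (K_le : forall m m', (m <= m')%N -> (K m <= K m')%N)
  (og : forall m, orthonormal mu (K m) g) (oh : forall m, orthonormal nu (K m) h)
  (mf : measurable_fun [set: X * Y] (fun z => f z.1 z.2))
  (lam_s : (fun m => \sum_(k < K m) \sum_(l < K m) lam k l ^+ 2) @ \oo --> s)
  (f_lim : forall e, 0 < e -> exists N, forall m, (N <= m)%N ->
    (moment2 P (fun w => f (xi 0%N w) (eta 0%N w) -
       trunc_kernel K lam g h m (xi 0%N w) (eta 0%N w))%R <= e%:E)%E)
  (Sinf_lim : forall e, 0 < e -> exists N, forall m, (N <= m)%N ->
    (moment2 Q (fun w => Sinf w -
       \sum_(k < K m) \sum_(l < K m) lam k l * tau k w * theta l w)%R <= e%:E)%E).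

Let S n1 n2 := S_L xi eta f (rect n1 n2).

Let iQ1 := indep_family_iid_l indQ.
Let iQ2 := indep_family_iid_r indQ.

Let mS n1 n2 : measurable_fun setT (S n1 n2). Proof. exact: (measurable_S_L ind). Qed.

Let mSm m n1 n2 : measurable_fun setT (S_L xi eta (trunc_kernel K lam g h m) (rect n1 n2)).
Proof. by apply: (measurable_S_L ind); apply: (measurable_trunc_kernel (mu := mu) (nu := nu)). Qed.

Let mG m : measurable_fun setT
  (fun w => \sum_(k < K m) \sum_(l < K m) lam k l * tau k w * theta l w).
Proof.
apply: measurable_sum => k; apply: measurable_sum => l.
by apply: measurable_funM; [apply: measurable_funM => //; exact: iQ1.1|exact: iQ2.1].
Qed.

Lemma cvg_test_smooth C phi : smooth_test C phi -> cvg_test P Q S Sinf phi.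
Proof.
move=> sphi; have [phiC _] := sphi; have [C0 p01 _] := phiC.
split; [exact: lip_test_measurable phiC|by exists 1 => x; case/andP: (p01 x) => ? ?; rewrite ger0_norm|].
move=> e e0; have C1 : 0 < C + 1 by rewrite ltr_wpDl.
(* With L_2 errors below r, each of the two truncations costs 2 C r <= e / 3; the last third is left
   to [bilinear_clt]. *)
pose r := e / 6 / (C + 1); have r0 : 0 < r by rewrite !divr_gt0.
have Cr : C * r + C / r * r ^+ 2 <= e / 3.
  have -> : C / r * r ^+ 2 = C * r by field; rewrite gt_eqF.
  have : C * r <= e / 6; last by lra.
  by rewrite /r mulrA ler_pdivrMr// mulrC ler_wpM2l ?lerDl// divr_ge0// ltW.
have [N1 H1] := moment2_S_L_trunc ind K_le og oh mf lam_s f_lim (exprn_gt0 2 r0).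
have [N2 H2] := Sinf_lim (exprn_gt0 2 r0).
pose m := maxn N1 N2.
have e30 : 0 < e / 3 by rewrite divr_gt0.
have [N3 H3] := bilinear_clt lam ind indQ (og m) (oh m) sphi e30.
exists (maxn 1 N3) => n1 n2; rewrite !geq_max => /andP[n10 n13] /andP[n20 n23].
have h1 := lip_test_close phiC (mS n1 n2) (mSm m n1 n2) r0 (H1 m (leq_maxl _ _) n1 n2 n10 n20).
have h2 := lip_test_close phiC mSinf (mG m) r0 (H2 m (leq_maxr _ _)).
have h3 := H3 n1 n2 n13 n23.
have E : \int[P]_w phi (S_L xi eta (trunc_kernel K lam g h m) (rect n1 n2) w) =
    \int[P]_w phi (\sum_(k < K m) \sum_(l < K m)
       lam k l * normalized_sum xi (g k) n1 w * normalized_sum eta (h l) n2 w).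
  by apply: eq_Rintegral => w _; rewrite /trunc_kernel S_L_bilinear.
rewrite -{}E in h3.
move: (le_trans h1 Cr) (le_trans h2 Cr) h3.
rewrite !ler_norml => /andP[? ?] /andP[? ?] /andP[? ?].
by apply/andP; split; lra.
Qed.

(** The second moments are bounded through one fixed truncation m: the errors have second moment at
    most 1 and the truncated forms exactly [sm], so 2 (1 + sm) bounds both sides. The bound starts
    at index 1, as the isometry needs non-empty rectangles. *)
Lemma S_L_cvg_test phi : continuous phi -> (exists D, forall x, `|phi x| <= D) ->
  cvg_test P Q S Sinf phi.
Proof.
have [N1 H1] := moment2_S_L_trunc ind K_le og oh mf lam_s f_lim ltr01.
have [N2 H2] := Sinf_lim ltr01.
pose m := maxn N1 N2.
pose sm := \sum_(k < K m) \sum_(l < K m) lam k l ^+ 2.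
apply: (@cvg_test_continuous _ _ _ _ _ P Q S Sinf (2 * (1 + sm)) 1) => //.
- move=> n1 n2 n10 n20.
  rewrite (_ : S n1 n2 = fun w => (S n1 n2 w - S_L xi eta (trunc_kernel K lam g h m) (rect n1 n2) w)
     + S_L xi eta (trunc_kernel K lam g h m) (rect n1 n2) w); last first.
    by apply/funext => w; rewrite subrK.
  apply: moment2D => //.
  + exact: measurable_funB.
  + by apply: H1 => //; rewrite leq_maxl.
  + by rewrite (moment2_S_L_bilinear ind lam (og m) (oh m) n10 n20).
- rewrite (_ : Sinf = fun w => (Sinf w -
     \sum_(k < K m) \sum_(l < K m) lam k l * tau k w * theta l w) +
     \sum_(k < K m) \sum_(l < K m) lam k l * tau k w * theta l w); last first.
    by apply/funext => w; rewrite subrK.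
  apply: moment2D => //.
  + exact: measurable_funB.
  + by apply: H2; rewrite leq_maxr.
  + have dQ : decoupled Q (K m) (tau : nat -> Om' -> R) theta.
      by apply: (indep_family_decoupled indQ (n1 := K m) (n2 := K m)) => k kK; exact: cyl_coord.
    by rewrite /moment2 (bilinear_moment2 lam (isometric_gauss (K m) iQ1) (isometric_gauss (K m) iQ2) dQ).
- exact: cvg_test_smooth.
Qed.

End limit.
Theorem theorem4p1 (R : realType) (dO dX dY : measure_display)
  (Om : measurableType dO) (X : measurableType dX) (Y : measurableType dY)
  (P : probability Om R) (mu : probability X R) (nu : probability Y R)
  (xi : nat -> Om -> X) (eta : nat -> Om -> Y)
  (M : option nat) (lam : nat -> nat -> R)
  (g : nat -> X -> R) (h : nat -> Y -> R) (f : X -> Y -> R)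
  (Z : nat -> X -> Y -> R) :
  indep_family P mu nu xi eta ->
  measurable_fun setT (fun z : X * Y => f z.1 z.2) ->
  (* g_k, h_l : centered orthonormal systems *)
  (forall k, inM M k -> measurable_fun setT (g k) /\
       mu.-integrable setT (fun x => (g k x ^+ 2)%:E)) ->
  (forall l, inM M l -> measurable_fun setT (h l) /\
       nu.-integrable setT (fun y => (h l y ^+ 2)%:E)) ->
  (forall k, inM M k -> (\int[mu]_x (g k x)%:E = 0)%E) ->
  (forall l, inM M l -> (\int[nu]_y (h l y)%:E = 0)%E) ->
  (forall k k', inM M k -> inM M k' ->
     (\int[mu]_x (g k x * g k' x)%:E = (k == k')%:R%:E)%E) ->
  (forall l l', inM M l -> inM M l' ->
     (\int[nu]_y (h l y * h l' y)%:E = (l == l')%:R%:E)%E) ->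
  (* sigma^2 = sum lam_{k,l}^2 in (0, oo) *)
  (exists s : R, 0 < s /\
     (fun m : nat => \sum_(k < m | inM M k) \sum_(l < m | inM M l) lam k l ^+ 2)
       @ \oo --> s) ->
  (* f = sum lam_{k,l} g_k(x) h_l(y), converging in L_2 *)
  (fun m : nat => pnorm P 2 (fun w => f (xi 0%N w) (eta 0%N w) -
       \sum_(k < m | inM M k) \sum_(l < m | inM M l)
          lam k l * g k (xi 0%N w) * h l (eta 0%N w))) @ \oo --> 0%E ->
  (* Z M is a minimizer Z_M[f] for p = 2, for every M >= 1 *)
  (forall m : nat, (0 < m)%N -> is_minimizer P mu nu (xi 0%N) (eta 0%N) 2 m f (Z m)) ->
  (* 0 < W[f](2) < oo *)
  (0 < W P mu nu (xi 0%N) (eta 0%N) 2 f Z < +oo)%E ->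
  (* conclusion: S_{L(n1,n2)}[f] -> S_oo in distribution *)
  forall (dO' : measure_display) (Om' : measurableType dO') (Q : probability Om' R)
         (tau theta : nat -> Om' -> R) (Sinf : Om' -> R),
    indep_family Q (normal_prob (0 : R) 1) (normal_prob (0 : R) 1) tau theta ->
    measurable_fun setT Sinf ->
    (fun m : nat => pnorm Q 2 (fun w => Sinf w -
       \sum_(k < m | inM M k) \sum_(l < m | inM M l) lam k l * tau k w * theta l w))
      @ \oo --> 0%E ->
    forall phi : R -> R, continuous phi -> (exists C : R, forall x, `|phi x| <= C) ->
    forall e : R, 0 < e -> exists N : nat, forall n1 n2 : nat,
      (N <= n1)%N -> (N <= n2)%N ->
      (`| \int[P]_w (phi (S_L xi eta f (rect n1 n2) w))%:E
          - \int[Q]_w (phi (Sinf w))%:E | < e%:E)%E.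

Proof.
move=> ind mf mg mh g0 h0 og oh [s [_ lam_s]] f_cvg _ _ dO' Om' Q tau theta Sinf indQ mSinf
  Sinf_cvg phi cphi bphi e e0.
pose K := trunc_size M.
have ogK m : orthonormal mu (K m) g.
  split=> [k /trunc_size_inM kM|k l /trunc_size_inM kM /trunc_size_inM lM].
    by split; [exact: (mg k kM).1|exact: g0].
  exact: og.
have ohK m : orthonormal nu (K m) h.
  split=> [k /trunc_size_inM kM|k l /trunc_size_inM kM /trunc_size_inM lM].
    by split; [exact: (mh k kM).1|exact: h0].
  exact: oh.
have lam_sK : (fun m => \sum_(k < K m) \sum_(l < K m) lam k l ^+ 2) @ \oo --> s.
  by under eq_fun do rewrite -(sum_inM2 M _ (fun k l => lam k l ^+ 2)).
have f_limK r : 0 < r -> exists N, forall m, (N <= m)%N ->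
    (moment2 P (fun w => f (xi 0%N w) (eta 0%N w) -
       trunc_kernel K lam g h m (xi 0%N w) (eta 0%N w))%R <= r%:E)%E.
  move=> r0; have [N HN] := pnorm2_cvg0 r0 f_cvg; exists N => m Nm.
  rewrite (_ : (fun w => _) = (fun w => f (xi 0%N w) (eta 0%N w) -
       \sum_(k < m | inM M k) \sum_(l < m | inM M l)
          lam k l * g k (xi 0%N w) * h l (eta 0%N w))); first exact: HN.
  apply/funext => w; rewrite /trunc_kernel.
  by rewrite (sum_inM2 M m (fun k l => lam k l * g k (xi 0%N w) * h l (eta 0%N w))).
have Sinf_limK r : 0 < r -> exists N, forall m, (N <= m)%N ->
    (moment2 Q (fun w => Sinf w -
       \sum_(k < K m) \sum_(l < K m) lam k l * tau k w * theta l w)%R <= r%:E)%E.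
  move=> r0; have [N HN] := pnorm2_cvg0 r0 Sinf_cvg; exists N => m Nm.
  rewrite (_ : (fun w => _) = (fun w => Sinf w -
       \sum_(k < m | inM M k) \sum_(l < m | inM M l) lam k l * tau k w * theta l w)); first exact: HN.
  by apply/funext => w; rewrite (sum_inM2 M m (fun k l => lam k l * tau k w * theta l w)).
have [mphi [D phiD] cvg] := S_L_cvg_test ind indQ mSinf (@trunc_size_le M) ogK ohK mf
  lam_sK f_limK Sinf_limK cphi bphi.
(* Half of e turns the non-strict bound of [cvg_test] into the strict one required. *)
have e20 : 0 < e / 2 by rewrite divr_gt0.
have [N HN] := cvg _ e20; exists N => n1 n2 Nn1 Nn2.
have EE d1 (T : measurableType d1) (m : probability T R) (V : T -> R) :
    measurable_fun setT V -> (\int[m]_w (phi (V w))%:E)%E = (\int[m]_w phi (V w))%:E.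
  move=> mV; rewrite fineK//; apply: integrable_fin_num => //.
  by apply: (@bounded_integrable _ _ _ m _ D) => [|x]; [exact: measurableT_comp|].
rewrite (EE _ _ P); last exact: (measurable_S_L ind).
rewrite (EE _ _ Q)// lte_fin.
apply: le_lt_trans (HN n1 n2 Nn1 Nn2) _.
by rewrite ltr_pdivrMr// mulr_natr mulr2n ltrDl.
Qed.
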